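(* Let $V$ be a graded vector space. For $f=\sum_{r\ge 0,s\ge 1} f_{r,s}\in \mathrm{Hom}^k(\mathsf{S}(V)\otimes \bar{\mathsf{S}}(V),V)$ and $g=\sum_{p\ge 0,q\ge 1} g_{p,q}\in \mathrm{Hom}^l(\mathsf{S}(V)\otimes \bar{\mathsf{S}}(V),V)$ define $f\circ g\in \mathrm{Hom}^{k+l}(\mathsf{S}(V)\otimes \bar{\mathsf{S}}(V),V)$ by its components ($n\ge 0$, $m\ge 1$) $$\begin{aligned} &(f\circ g)_{n,m}(x_1 \cdots x_n\otimes x_{n+1} \cdots x_{n+m})\\ =&\sum_{\substack{0\le p\le n-1,\,1\le q\le n\\ p+q\le n}}\ \sum_{\sigma\in \mathbb S_{(p,q,n-p-q)}}\varepsilon(\sigma)f_{n-p-q+1,m}\Big(g_{p,q}(x_{\sigma(1)} \cdots x_{\sigma(p)}\otimes x_{\sigma(p+1)} \cdots x_{\sigma(p+q)})\, x_{\sigma(p+q+1)} \cdots x_{\sigma(n)}\otimes x_{n+1} \cdots x_{n+m}\Big)\\ &+\sum_{0\le p\le n}\ \sum_{\sigma\in\mathbb S_{(n-p,p)}}\ \sum_{1\le q\le m}\ \sum_{\tau\in\mathbb S_{(q,m-q)}}\varepsilon(\sigma)\varepsilon(\tau)(-1)^{l(x_{\sigma(1)}+\cdots+x_{\sigma(n-p)})}\\ &\qquad f_{n-p,m-q+1}\Big(x_{\sigma(1)} \cdots x_{\sigma(n-p)}\otimes g_{p,q}(x_{\sigma(n-p+1)} \cdots x_{\sigma(n)}\otimes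 x_{n+\tau(1)} \cdots x_{n+\tau(q)})\, x_{n+\tau(q+1)} \cdots x_{n+\tau(m)}\Big). \end{aligned}$$ Then $\mathrm{Hom}(\mathsf{S}(V)\otimes \bar{\mathsf{S}}(V),V)$ with the bracket $$[f,g]_{\mathsf{PL}}:=f\circ g-(-1)^{kl}g\circ f$$ is a graded Lie algebra.
   Context: The ground field $\mathbf k$ has characteristic zero; graded means $\mathbb Z$-graded. In exponents of $-1$, a homogeneous element stands for its degree. $\mathsf{S}(V)=\bigoplus_{n\ge 0}\mathsf{S}^n(V)$ is the (graded) symmetric algebra of $V$ and $\bar{\mathsf{S}}(V)=\bigoplus_{n\ge 1}\mathsf{S}^n(V)$; products in $\mathsf S(V)$ are written by juxtaposition. $\mathbb S_{(i_1,\dots,i_k)}$ is the set of $(i_1,\dots,i_k)$-shuffles (permutations increasing on each of the consecutive blocks of lengths $i_1,\dots,i_k$). $\varepsilon(\sigma)$ is the Koszul sign, defined by $v_1\cdots v_n=\varepsilon(\sigma)v_{\sigma(1)}\cdots v_{\sigma(n)}$ in $\mathsf S(V)$ (for $\tau$ it is computed with respect to $x_{n+1},\dots,x_{n+m}$). $\mathrm{Hom}^k(\mathsf{S}(V)\otimes \bar{\mathsf{S}}(V),V)$ is the space of linear maps of degree $k$; such a map $f$ is the sum of its components $f_{p,q}:\mathsf{S}^p(V)\otimes \mathsf{S}^q(V)\to V$, $p\ge 0$, $q\ge 1$. $\mathrm{Hom}(\mathsf{S}(V)\otimes \bar{\mathsf{S}}(V),V)=\bigoplus_{k\in\mathbb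 Z}\mathrm{Hom}^k(\mathsf{S}(V)\otimes \bar{\mathsf{S}}(V),V)$. *)

(* Defs.v *)
From HB Require Import structures.
From mathcomp Require Import all_boot all_algebra perm.
From mathcomp Require Import boolp classical_sets functions.
From mathcomp Require Import monalg.

Set Implicit Arguments.
Unset Strict Implicit.
Unset Printing Implicit Defensive.

Import GRing.Theory Quotient.Exports.
Local Open Scope quotient_scope.
Local Open Scope ring_scope.

Section Span.
Variables (K : fieldType) (A : lmodType K) (G : A -> Prop).

Inductive lspan : A -> Prop :=
| lspan0 : lspan 0
| lspanS (a : K) x y : G x -> lspan y -> lspan (a *: x + y).

Definition spanp : A -> bool := fun x => `[< lspan x >].

Lemma lspanD x y : lspan x -> lspan y -> lspan (x + y).
Proof.
move=> + sy; elim=> [|a u v Gu _ IH]; first by rewrite add0r.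
by rewrite -addrA; apply: lspanS.
Qed.

Lemma lspanZ a x : lspan x -> lspan (a *: x).
Proof.
elim=> [|b u v Gu _ IH]; first by rewrite scaler0; apply: lspan0.
by rewrite scalerDr scalerA; apply: lspanS.
Qed.

Lemma sub_lspan x : G x -> lspan x.
Proof. by move=> Gx; rewrite -[x]scale1r -[_ *: _]addr0; apply/lspanS/lspan0. Qed.

Lemma spanp_submod_closed : submod_closed spanp.
Proof.
split=> [|a x y]; first exact/asboolP/lspan0.
by move=> /asboolP sx /asboolP sy; apply/asboolP/lspanD => //; apply: lspanZ.
Qed.

HB.instance Definition _ := GRing.isSubmodClosed.Build K A spanp
  spanp_submod_closed.

Record spanned := Spanned { spanned_val : A; _ : spanned_val \in spanp }.
HB.instance Definition _ := [isSub for spanned_val].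
HB.instance Definition _ := [Choice of spanned by <:].
HB.instance Definition _ := [SubChoice_isSubLmodule of spanned by <:].

Definition modspan := Quotient.quot (GRing.ZmodClosed.clone A spanp _).
HB.instance Definition _ := ZmodQuotient.on modspan.

Definition modspan_pi : A -> modspan := \pi_modspan.

Definition modspan_scale (a : K) (x : modspan) : modspan :=
  modspan_pi (a *: repr x).

Lemma modspan_reprK x : modspan_pi (repr x) = x.
Proof. exact: reprK. Qed.

Lemma modspan_piZ a x : modspan_pi (a *: x) = modspan_scale a (modspan_pi x).
Proof.
apply/eqP; rewrite -Quotient.idealrBE -scalerBr; apply: rpredZ.
by rewrite Quotient.idealrBE /modspan_pi reprK.
Qed.
Lemma modspan_piD x y : modspan_pi (x + y) = modspan_pi x + modspan_pi y.
Proof. exact: (@Quotient.pi_add A). Qed.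

Lemma modspan_rel x : G x -> modspan_pi x = modspan_pi 0.
Proof.
move=> Gx; apply/eqP; rewrite -Quotient.idealrBE subr0.
exact/asboolP/sub_lspan.
Qed.

Lemma modspan_scaleA a b x :
  modspan_scale a (modspan_scale b x) = modspan_scale (a * b) x.
Proof. by rewrite -[x]modspan_reprK -!modspan_piZ scalerA. Qed.
Lemma modspan_scale1 : left_id 1 modspan_scale.
Proof. by move=> x; rewrite -[x]modspan_reprK -modspan_piZ scale1r. Qed.
Lemma modspan_scaleDr : right_distributive modspan_scale +%R.
Proof.
move=> a x y; rewrite -[x]modspan_reprK -[y]modspan_reprK -modspan_piD -!modspan_piZ.
by rewrite scalerDr modspan_piD.
Qed.
Lemma modspan_scaleDl x : {morph modspan_scale^~ x : a b / a + b}.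
Proof.
by move=> a b /=; rewrite -[x]modspan_reprK -!modspan_piZ scalerDl modspan_piD.
Qed.
HB.instance Definition _ := GRing.Zmodule_isLmodule.Build K modspan
  modspan_scaleA modspan_scale1 modspan_scaleDr modspan_scaleDl.

Lemma modspan_pi_linear : linear modspan_pi.
Proof. by move=> a x y; rewrite modspan_piD modspan_piZ. Qed.
HB.instance Definition _ := GRing.isLinear.Build K A modspan *:%R modspan_pi
  modspan_pi_linear.

End Span.

Section Graded.
Variables (K : fieldType) (A : lmodType K) (D : int -> A -> Prop).

(* [D i] is the degree-[i] piece of an internal direct sum decomposition. *)
Definition is_grading : Prop :=
  [/\ forall i, D i 0 /\ (forall a x y, D i x -> D i y -> D i (a *: x + y)),
      forall x, lspan (fun y => exists i, D i y) x
    & forall (s : seq int) (x : int -> A), uniq s ->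
        (forall i, D i (x i)) -> \sum_(i <- s) x i = 0 ->
        forall i, i \in s -> x i = 0].

Definition bilinear_op (b : A -> A -> A) : Prop :=
  (forall x, linear (b x)) /\ (forall y, linear (b^~ y)).

Definition is_graded_lie (br : A -> A -> A) : Prop :=
  [/\ is_grading,
      bilinear_op br,
      forall k l x y, D k x -> D l y -> D (k + l) (br x y),
      forall k l x y, D k x -> D l y ->
        br x y = - ((-1) ^ (k * l) *: br y x)
    & forall k l m x y z, D k x -> D l y -> D m z ->
        br x (br y z) = br (br x y) z + (-1) ^ (k * l) *: br y (br x z)].

End Graded.

Section Tensor.
Variables (K : fieldType) (U W : lmodType K).

Inductive tensor_rel : {malg K[(U * W)%type]} -> Prop :=
| tensor_rell a u u' w :
    tensor_rel (<< (a *: u + u', w) >> - (a *: << (u, w) >> + << (u', w) >>))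
| tensor_relr a u w w' :
    tensor_rel (<< (u, a *: w + w') >> - (a *: << (u, w) >> + << (u, w') >>)).

Definition tensor := modspan tensor_rel.
HB.instance Definition _ := GRing.Lmodule.on tensor.

Definition tens (u : U) (w : W) : tensor := modspan_pi tensor_rel << (u, w) >>.

End Tensor.

Section Koszul.
Variable K : fieldType.

(* [shuffle b s]: [s] is increasing on each of the consecutive blocks of
   lengths [b]. *)
Definition shuffle (b : seq nat) n (s : 'S_n) : bool :=
  [forall i : 'I_n, forall j : 'I_n,
    (i < j)%N && (reshape_index b i == reshape_index b j) ==> (s i < s j)%N].

(* The Koszul sign, one factor per inversion; see [mon_koszul]. *)
Definition koszul n (d : 'I_n -> int) (s : 'S_n) : K :=
  \prod_(i < n) \prod_(j < n | (i < j)%N && (s j < s i)%N)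
    (-1) ^ (d (s i) * d (s j)).

End Koszul.

Section Sym.
Variables (K : fieldType) (V : lmodType K) (Vdeg : int -> V -> Prop).

(* S(V) is the tensor algebra of V, that is, words modulo multilinearity,
   modulo the ideal generated by graded commutators. *)
Inductive sym_rel : {malg K[seq V]} -> Prop :=
| sym_rel_lin a u v w w' :
    sym_rel (<< w ++ (a *: u + v) :: w' >>
             - (a *: << w ++ u :: w' >> + << w ++ v :: w' >>))
| sym_rel_comm i j u v w w' : Vdeg i u -> Vdeg j v ->
    sym_rel (<< w ++ [:: u, v & w'] >>
             - (-1) ^ (i * j) *: << w ++ [:: v, u & w'] >>).

Definition sym := modspan sym_rel.
HB.instance Definition _ := GRing.Lmodule.on sym.

(* The product in S(V) of the elements of a word. *)
Definition mon (w : seq V) : sym := modspan_pi sym_rel << w >>.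

Definition sympow (n : nat) : sym -> Prop :=
  lspan (fun x => exists2 w, size w = n & x = mon w).

Definition symbar := spanned (fun x : sym => exists2 n, (0 < n)%N & sympow n x).
HB.instance Definition _ := SubChoice.on symbar.
HB.instance Definition _ := GRing.Lmodule.on symbar.

(* Only meaningful for nonempty words, see [val_monbar]; 0 on [::]. *)
Definition monbar (w : seq V) : symbar := insubd (0 : symbar) (mon w).

Lemma val_monbar w : w != [::] -> val (monbar w) = mon w.
Proof.
move=> w0; rewrite val_insubd ifT //; apply/asboolP/sub_lspan.
by exists (size w); [rewrite lt0n size_eq0 | apply: sub_lspan; exists w].
Qed.

Inductive word_deg : int -> seq V -> Prop :=
| word_deg0 : word_deg 0 [::]
| word_degS i d v w : Vdeg i v -> word_deg d w -> word_deg (i + d) (v :: w).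

Definition sym_deg (d : int) : sym -> Prop :=
  lspan (fun x => exists2 w, word_deg d w & x = mon w).

Definition stens := tensor sym symbar.
HB.instance Definition _ := GRing.Lmodule.on stens.

Definition stens_deg (d : int) : stens -> Prop :=
  lspan (fun t => exists a b x y,
    [/\ sym_deg a x, sym_deg b (val y), a + b = d & t = tens x y]).

Definition hom_deg (k : int) (f : stens -> V) : Prop :=
  linear f /\ forall d t, stens_deg d t -> Vdeg (d + k) (f t).

(* The direct sum of the Hom^k, inside all maps. *)
Definition gHom := spanned (fun f : stens -> V => exists k, hom_deg k f).
HB.instance Definition _ := SubChoice.on gHom.
HB.instance Definition _ := GRing.Lmodule.on gHom.

Definition gHom_deg (k : int) (f : gHom) : Prop := hom_deg k (val f).

(* f_{p,q}(w (x) w'), where p and q are the lengths of [w] and [w']. *)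
Definition ev (f : gHom) (w w' : seq V) : V := val f (tens (mon w) (monbar w')).

Definition word n (x : 'I_n -> V) : seq V := [seq x i | i <- enum 'I_n].

Section KoszulSign.
Variables (n : nat) (x : 'I_n -> V) (d : 'I_n -> int).
Hypothesis dx : forall i, Vdeg (d i) (x i).

Let e (a b : 'I_n) : K := (-1) ^ (d a * d b).

Fixpoint kseq (r : seq 'I_n) : K :=
  if r is a :: r' then (\prod_(b <- r' | (b < a)%N) e a b) * kseq r' else 1.

Lemma kseq_swap p a b v : a != b ->
  kseq (p ++ [:: a, b & v]) = e a b * kseq (p ++ [:: b, a & v]).
Proof.
have ee u w : e u w * e u w = 1 by rewrite /e -expfzMl mulrNN mulr1 exp1rz.
have eC u w : e u w = e w u by rewrite /e mulrC.
move=> ab; elim: p => [|c p IH] /=; last first.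
  rewrite IH mulrCA; congr (_ * (_ * _)); apply: perm_big.
  by rewrite perm_cat2l (perm_catCA [:: a] [:: b]).
rewrite !big_cons; case: ltngtP => [ba|ba|/val_inj ba]; last first.
- by rewrite ba eqxx in ab.
- by rewrite -!mulrA (eC b a) [RHS]mulrA ee mul1r [RHS]mulrCA.
- by rewrite -!mulrA; congr (_ * _); rewrite [RHS]mulrCA.
Qed.

Let phi r : sym := kseq r *: mon (map x r).

Lemma phi_front p a u v : a \notin u ->
  phi (p ++ u ++ a :: v) = phi (p ++ a :: u ++ v).
Proof.
elim: u p => //= b u IH p; rewrite inE negb_or => /andP[ab au].
rewrite -cat_rcons IH // cat_rcons /phi kseq_swap 1?eq_sym //.
have -> : mon (map x (p ++ [:: a, b & u ++ v])) =
          e a b *: mon (map x (p ++ [:: b, a & u ++ v])).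
  rewrite !map_cat /=; apply/eqP; rewrite -subr_eq0 /mon -!linearZ -linearB.
  apply/eqP; rewrite -[RHS](linear0 (modspan_pi sym_rel)).
  by apply: modspan_rel; apply: sym_rel_comm.
by rewrite scalerA /e mulrC [d b * _]mulrC.
Qed.

Lemma phi_perm p r r' : uniq r -> perm_eq r r' -> phi (p ++ r) = phi (p ++ r').
Proof.
elim: r p r' => [|a r IH] p r' /=; first by rewrite perm_sym => _ /perm_nilP->.
case/andP=> ar ur rr'; have ar' : a \in r' by rewrite -(perm_mem rr') mem_head.
case/splitPr: ar' rr' => u v rr'.
have {rr'} rr' : perm_eq r (u ++ v).
  by rewrite -(perm_cons a) (perm_trans rr') // (perm_catCA u [:: a]).
have au : a \notin u by apply: contra ar => au; rewrite (perm_mem rr') mem_cat au.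
by rewrite phi_front // -!cat_rcons; apply: IH.
Qed.

Lemma kseq_map (s : 'S_n) t : sorted ltn (map val t) ->
  kseq (map s t) =
  \prod_(i <- t) \prod_(j <- t | (i < j)%N && (s j < s i)%N) e (s i) (s j).
Proof.
elim: t => [|a t IH] /=; first by rewrite big_nil.
rewrite (path_sortedE ltn_trans) => /andP[/allP at_ st].
have {}at_ i : i \in t -> (a < i)%N by move=> it; apply/at_/map_f.
rewrite big_cons big_cons ltnn /= IH // big_map; congr (_ * _).
  rewrite big_seq_cond [RHS]big_seq_cond; apply: eq_bigl => i.
  by case: (boolP (i \in t)) => //= /at_ ->.
by apply: eq_big_seq => i /at_ ai; rewrite big_cons ltnNge (ltnW ai).
Qed.

(* v_1 ... v_n = epsilon(s) v_{s(1)} ... v_{s(n)} *)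
Lemma mon_koszul (s : 'S_n) :
  mon (word x) = koszul K d s *: mon (word (x \o s)).
Proof.
have se : sorted ltn (map val (enum 'I_n)) by rewrite val_enum_ord iota_ltn_sorted.
have key (s' : 'S_n) : kseq (map s' (enum 'I_n)) = koszul K d s'.
  rewrite kseq_map // big_enum; apply: eq_bigr => i _.
  by rewrite big_enum_cond.
have <- : phi (map (1%g : 'S_n) (enum 'I_n)) = mon (word x).
  rewrite /phi key (eq_map (@perm1 _)) map_id /koszul.
  rewrite big1 ?scale1r // => i _; rewrite big1 // => j.
  by rewrite !perm1 => /andP[/ltnW]; rewrite leqNgt => /negPf->.
rewrite -key /word (map_comp x s) -/(phi _); apply: (@phi_perm [::]).
  by rewrite map_inj_uniq ?enum_uniq //; apply: perm_inj.
have mem_s (s' : 'S_n) i : i \in map s' (enum 'I_n).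
  by rewrite -(permKV s' i) map_f ?mem_enum.
apply: uniq_perm => [||i]; last by rewrite !mem_s.
  by rewrite map_inj_uniq ?enum_uniq //; apply: perm_inj.
by rewrite map_inj_uniq ?enum_uniq //; apply: perm_inj.
Qed.

End KoszulSign.

(* The right-hand side of the definition of f o g, for g of degree [l], at
   x_1 ... x_n (x) y_1 ... y_m, where y_j stands for x_{n+j} and [dx], [dy]
   are the degrees of the x_i and y_j. *)
Definition circ_rhs (l : int) (f g : gHom) n m (x : 'I_n -> V) (dx : 'I_n -> int)
    (y : 'I_m -> V) (dy : 'I_m -> int) : V :=
  (\sum_(0 <= p < n) \sum_(1 <= q < n.+1 | (p + q <= n)%N)
    \sum_(s : 'S_n | shuffle [:: p; q; n - p - q]%N s)
     (let w := word (x \o s) in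
      koszul K dx s *:
      ev f (ev g (take p w) (take q (drop p w)) :: drop (p + q)%N w) (word y)))
  + (\sum_(0 <= p < n.+1) \sum_(s : 'S_n | shuffle [:: n - p; p]%N s)
    \sum_(1 <= q < m.+1) \sum_(t : 'S_m | shuffle [:: q; m - q]%N t)
     (let w := word (x \o s) in
      let w' := word (y \o t) in
      (koszul K dx s * koszul K dy t
       * (-1) ^ (l * (\sum_(i < n | (i < n - p)%N) dx (s i)))) *:
      ev f (take (n - p)%N w)
           (ev g (drop (n - p)%N w) (take q w') :: drop q w'))).

Definition is_circ (circ : gHom -> gHom -> gHom) : Prop :=
  bilinear_op circ /\
  forall k l f g, gHom_deg k f -> gHom_deg l g ->
    gHom_deg (k + l) (circ f g) /\
    forall n m x dx y dy, (0 < m)%N ->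
      (forall i : 'I_n, Vdeg (dx i) (x i)) ->
      (forall j : 'I_m, Vdeg (dy j) (y j)) ->
      ev (circ f g) (word x) (word y) = circ_rhs l f g x dx y dy.

Definition is_PL_bracket (circ br : gHom -> gHom -> gHom) : Prop :=
  bilinear_op br /\
  forall k l f g, gHom_deg k f -> gHom_deg l g ->
    br f g = circ f g - (-1) ^ (k * l) *: circ g f.

End Sym.

(* Main.v *)
Require Import Defs.
From HB Require Import structures.
From mathcomp Require Import all_boot all_algebra perm.
From mathcomp Require Import boolp classical_sets functions.
From mathcomp Require Import finmap monalg.
From mathcomp Require Import ring.

Set Implicit Arguments.
Unset Strict Implicit.
Unset Printing Implicit Defensive.

Import GRing.Theory Quotient.Exports.
Local Open Scope quotient_scope.
Local Open Scope ring_scope.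

(* A map [f] on S(V) (x) Sbar(V) is encoded as a multilinear, graded symmetric
   map on words in letters of two colours, that is, on S(V (+) V); [f] gives
   values of colour [true], and the sum of [f] over all recolourings of a
   monochromatic word gives values of colour [false].  The two together extend
   to a coderivation D_f of the cofree coalgebra S(V (+) V), and the product
   [f o g] becomes the composite of [f] with D_g.  Its associator is therefore
   the part of D_g D_h in which neither map is inserted into the other, which
   is graded symmetric in [g] and [h]: the product is graded (right) pre-Lie,
   so its graded commutator is a Lie bracket.  The formula with shuffles comes
   from the recursion defining a coderivation: a shuffle with three blocks is a
   colouring of the letters by three colours, and its Koszul sign is a product
   over the pairs whose colours are inverted. *)

(** * Linear combinations *)

(** Recolouring is induced by an idempotent of V (+) V and commutes with D_g ([act_extend]). Hence
    the extension of f o g is, in both colours, the extension of f composed with D_g; this is what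
    makes f o (g o h) cancel the nested insertions. The obstacle is the signs: they depend on
    degrees, while vectors and maps need not be homogeneous and the product must be bilinear. Only
    parities matter, so a letter names one parity component of its vector and every sign has a
    boolean exponent. Partial evaluation [fun u => phi (x :: u)] then turns the identities into
    inductions on words in which no permutation occurs. Permutations enter only when the recursion
    is unfolded into the required formula; there a map is 0 as soon as its second word is empty,
    which explains the bounds q >= 1 and p <= n - 1. *)

Section LinearCombinations.
Variables (R : comNzRingType) (M : lmodType R).

Inductive lexpr :=
  LAtom of nat | LZero | LAdd of lexpr & lexpr | LOpp of lexpr
| LScale of R & lexpr.

Fixpoint leval (env : seq M) e : M :=
  match e with
  | LAtom i => env`_i
  | LZero => 0
  | LAdd a b => leval env a + leval env b
  | LOpp a => - leval env a
  | LScale c a => c *: leval env a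
  end.

(** [eqn] instead of [==] lets [cbn] decide which atom is meant, so that only scalar equations
    remain after reflection. *)
Fixpoint lcoef (i : nat) e : R :=
  match e with
  | LAtom j => if eqn j i then 1 else 0
  | LZero => 0
  | LAdd a b => lcoef i a + lcoef i b
  | LOpp a => - lcoef i a
  | LScale c a => c * lcoef i a
  end.

Fixpoint lcoef_eq n e e' : Prop :=
  if n is m.+1 then lcoef_eq m e e' /\ lcoef m e = lcoef m e' else True.

Lemma leval_sum env e :
  leval env e = \sum_(i < size env) lcoef i e *: env`_i.
Proof.
elim: e => [j||a IHa b IHb|a IHa|c a IHa] /=.
- have [jn|jn] := ltnP j (size env); last first.
    rewrite nth_default // big1 // => i _; rewrite -[eqn _ _]/(j == i :> nat).
    by case: eqP (leq_trans (ltn_ord i) jn) => [->|_]; rewrite ?ltnn ?scale0r.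
  rewrite (bigD1 (Ordinal jn)) //= -[eqn _ _]/(j == j) eqxx scale1r big1 ?addr0 // => i.
  by rewrite -val_eqE eq_sym /= -[eqn _ _]/(j == i :> nat) => /negPf ->; rewrite scale0r.
- by rewrite big1 // => i _; rewrite scale0r.
- by rewrite IHa IHb -big_split; apply: eq_bigr => i _; rewrite scalerDl.
- by rewrite IHa -sumrN; apply: eq_bigr => i _; rewrite scaleNr.
- by rewrite IHa scaler_sumr; apply: eq_bigr => i _; rewrite scalerA.
Qed.

Lemma leval_eq env e e' :
  lcoef_eq (size env) e e' -> leval env e = leval env e'.
Proof.
rewrite !leval_sum; elim: (size env) => [|n IH] /=; first by rewrite !big_ord0.
by case=> /IH H H'; rewrite !big_ord_recr /= H H'.
Qed.

End LinearCombinations.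

Ltac lmod_idx x env :=
  lazymatch env with
  | cons x _ => constr:(O)
  | cons _ ?env' => let i := lmod_idx x env' in constr:(S i)
  end.

Ltac lmod_env t env :=
  lazymatch t with
  | @GRing.add _ ?a ?b => let env' := lmod_env a env in lmod_env b env'
  | @GRing.opp _ ?a => lmod_env a env
  | @GRing.zero _ => env
  | @GRing.scale _ _ _ ?a => lmod_env a env
  | _ => match env with
         | _ => let _ := lmod_idx t env in env
         | _ => constr:(cons t env)
         end
  end.

Ltac lmod_reify R t env :=
  lazymatch t with
  | @GRing.add _ ?a ?b =>
      let a' := lmod_reify R a env in
      let b' := lmod_reify R b env in constr:(@LAdd R a' b')
  | @GRing.opp _ ?a => let a' := lmod_reify R a env in constr:(@LOpp R a')
  | @GRing.zero _ => constr:(@LZero R)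
  | @GRing.scale _ _ ?c ?a =>
      let a' := lmod_reify R a env in constr:(@LScale R c a')
  | _ => let i := lmod_idx t env in constr:(@LAtom R i)
  end.

(* Reduces an equation between linear combinations in the [R]-module [M] to
   equations between the coefficients of each atom. *)
Ltac lmod_split R M :=
  lazymatch goal with
  | |- @eq _ ?a ?b =>
    let env0 := lmod_env a (@nil M) in
    let env := lmod_env b env0 in
    let a' := lmod_reify R a env in
    let b' := lmod_reify R b env in
    change (@leval R M env a' = @leval R M env b'); apply: leval_eq;
    cbn [lcoef_eq lcoef eqn size]; repeat split
  end.

Ltac bool_atom e :=
  lazymatch e with
  | andb ?a _ => bool_atom a
  | addb ?a _ => bool_atom a
  | negb ?a => bool_atom a
  | _ => e
  end.

(* Closes the remaining equations when each coefficient is a sum of products of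
   scalars and signs [(-1) ^+ b], by case analysis on the atoms of each [b]. *)
Ltac lmod_signs R M :=
  lmod_split R M;
  repeat (rewrite /= ?expr0 ?expr1;
    match goal with |- context [nat_of_bool ?e] =>
      let a := bool_atom e in case: a end);
  ring.

(** * Coderivations on words in two colours *)

(* A letter carries a colour ([false] for the letters of the S(V) factor,
   [true] for those of the other factor), a parity and a vector; it stands for
   the component of that parity of the vector. *)
Notation letter V := (bool * (bool * V))%type.

Section Insertion.
Variables (K : fieldType) (V U : lmodType K).

Definition color (x : letter V) : bool := x.1.
Definition par (x : letter V) : bool := x.2.1.
Definition lab (c b : bool) (v : V) : letter V := (c, (b, v)).
Lemma parE c b v : par (lab c b v) = b. Proof. by []. Qed.

Fixpoint wpar (w : seq (letter V)) : bool :=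
  if w is x :: w' then par x (+) wpar w' else false.

Definition multilin (phi : seq (letter V) -> U) : Prop :=
  forall u c b a v v' w,
    phi (u ++ lab c b (a *: v + v') :: w) =
    a *: phi (u ++ lab c b v :: w) + phi (u ++ lab c b v' :: w).

Definition supersym (phi : seq (letter V) -> U) : Prop :=
  forall u x y w,
    phi (u ++ [:: x, y & w]) = (-1) ^+ (par x && par y) *: phi (u ++ [:: y, x & w]).

Lemma multilin_cons phi x : multilin phi -> multilin (fun w => phi (x :: w)).
Proof. by move=> H u; apply: (H (x :: u)). Qed.

Lemma supersym_cons phi x : supersym phi -> supersym (fun w => phi (x :: w)).
Proof. by move=> H u; apply: (H (x :: u)). Qed.

Lemma multilin0 phi u c b w : multilin phi -> phi (u ++ lab c b 0 :: w) = 0.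
Proof.
move=> H; have := H u c b (-1) 0 0 w; rewrite scaleN1r addNr => ->.
by rewrite scaleN1r addNr.
Qed.

Lemma supersym_front phi u x w : supersym phi ->
  phi (u ++ x :: w) = (-1) ^+ (par x && wpar u) *: phi (x :: u ++ w).
Proof.
elim: u phi => [|y u IH] phi H /=; first by rewrite andbF scale1r.
rewrite (IH _ (supersym_cons _ H)) (H [::]) /=.
lmod_signs K U.
Qed.

(* [ins c k h phi] is the composite of [phi] with the coderivation extending
   [h], of parity [k] and with values in the letters of colour [c]; the value
   of [h] is moved to the end of the word. *)
Fixpoint ins (c k : bool) (h : seq (letter V) -> V) (phi : seq (letter V) -> U)
    (w : seq (letter V)) : U :=
  if w is x :: w' then
    (-1) ^+ (k && par x) *: ins c k h (fun u => phi (x :: u)) w'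
    + ins c (k (+) par x) (fun u => h (x :: u)) phi w'
  else phi [:: lab c k (h [::])].

Lemma ins_ZDr c k h a phi psi w :
  ins c k h (fun u => a *: phi u + psi u) w
  = a *: ins c k h phi w + ins c k h psi w.
Proof.
elim: w k h phi psi => //= x w IH k h phi psi; rewrite !IH; lmod_signs K U.
Qed.

Lemma ins_Dr c k h phi psi w :
  ins c k h (fun u => phi u + psi u) w = ins c k h phi w + ins c k h psi w.
Proof.
elim: w k h phi psi => //= x w IH k h phi psi; rewrite !IH; lmod_signs K U.
Qed.

Lemma ins_0r c k h w : ins c k h (fun _ => 0) w = 0.
Proof. by elim: w k h => //= x w IH k h; rewrite !IH scaler0 addr0. Qed.

Lemma ins_Zr c k h a phi w :
  ins c k h (fun u => a *: phi u) w = a *: ins c k h phi w.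
Proof. elim: w k h phi => //= x w IH k h phi; rewrite !IH; lmod_signs K U. Qed.

Lemma ins_ZDl c k a h h' phi w : multilin phi ->
  ins c k (fun u => a *: h u + h' u) phi w = a *: ins c k h phi w + ins c k h' phi w.
Proof.
elim: w k h h' phi => [|x w IH] k h h' phi H /=; first exact: (H [::]).
rewrite !IH //; last exact: multilin_cons.
lmod_signs K U.
Qed.

Lemma ins_Dl c k h h' phi w : multilin phi ->
  ins c k (fun u => h u + h' u) phi w = ins c k h phi w + ins c k h' phi w.
Proof.
move=> H; rewrite -[ins c k h phi w]scale1r -ins_ZDl //.
by congr ins; apply/funext => u; rewrite scale1r.
Qed.

Lemma ins_0l c k phi w : multilin phi -> ins c k (fun _ => 0) phi w = 0.
Proof.
elim: w k phi => [|x w IH] k phi H /=; first exact: (multilin0 [::]).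
by rewrite !IH ?scaler0 ?addr0 //; apply: multilin_cons.
Qed.

Lemma ins_Zl c k a h phi w : multilin phi ->
  ins c k (fun u => a *: h u) phi w = a *: ins c k h phi w.
Proof.
move=> H; rewrite -[RHS]addr0 -[X in _ + X](ins_0l c k w H) -ins_ZDl //.
by congr ins; apply/funext => u; rewrite addr0.
Qed.

End Insertion.

Section InsertionInvariance.
Variables (K : fieldType) (V U : lmodType K).
Implicit Types (h : seq (letter V) -> V) (phi : seq (letter V) -> U).

Lemma ins_multilin c k h phi :
  multilin h -> multilin phi -> multilin (ins c k h phi).
Proof.
move=> Hh Hphi u; elim: u k h phi Hh Hphi => [|x u IH] k h phi Hh Hphi d b a v v' w /=.
  have -> : (fun w => phi (lab d b (a *: v + v') :: w))
    = (fun w => a *: phi (lab d b v :: w) + phi (lab d b v' :: w)).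
    by apply/funext => w'; apply: (Hphi [::]).
  have -> : (fun w => h (lab d b (a *: v + v') :: w))
    = (fun w => a *: h (lab d b v :: w) + h (lab d b v' :: w)).
    by apply/funext => w'; apply: (Hh [::]).
  rewrite ins_ZDr ins_ZDl // !parE; lmod_signs K U.
rewrite !IH //; try exact: multilin_cons.
lmod_signs K U.
Qed.

Lemma ins_supersym c k h phi :
  multilin phi -> supersym h -> supersym phi -> supersym (ins c k h phi).
Proof.
move=> Mphi Hh Hphi u.
elim: u k h phi Mphi Hh Hphi => [|z u IH] k h phi Mphi Hh Hphi x y w /=.
  have -> : (fun w => phi [:: x, y & w])
    = (fun w => (-1) ^+ (par x && par y) *: phi [:: y, x & w]).
    by apply/funext => w'; apply: (Hphi [::]).
  have -> : (fun w => h [:: x, y & w])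
    = (fun w => (-1) ^+ (par x && par y) *: h [:: y, x & w]).
    by apply/funext => w'; apply: (Hh [::]).
  rewrite ins_Zr ins_Zl // ![k (+) par x (+) _]addbAC; lmod_signs K U.
rewrite (IH k h) ?(IH (k (+) par z) _ _ _ _ _ x y) //;
  try exact: multilin_cons; try exact: supersym_cons.
lmod_signs K U.
Qed.

Variable pi : bool -> V -> V.

(** For [pi] the parity projections, this says that [phi] sees of each letter only the component of
    the labelled parity. *)
Definition proj_inv (phi : seq (letter V) -> U) : Prop :=
  forall u c b v w, phi (u ++ lab c b (pi b v) :: w) = phi (u ++ lab c b v :: w).

Lemma proj_inv_cons phi x : proj_inv phi -> proj_inv (fun w => phi (x :: w)).
Proof. by move=> H u; apply: (H (x :: u)). Qed.

End InsertionInvariance.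

Lemma ins_proj_inv (K : fieldType) (V U : lmodType K) (pi : bool -> V -> V) c k
    (h : seq (letter V) -> V) (phi : seq (letter V) -> U) :
  proj_inv pi h -> proj_inv pi phi -> proj_inv pi (ins c k h phi).
Proof.
move=> Hh Hphi u; elim: u k h phi Hh Hphi => [|x u IH] k h phi Hh Hphi d b v w /=.
  have -> : (fun w => phi (lab d b (pi b v) :: w)) = (fun w => phi (lab d b v :: w)).
    by apply/funext => w'; apply: (Hphi [::]).
  have -> // : (fun w => h (lab d b (pi b v) :: w)) = (fun w => h (lab d b v :: w)).
  by apply/funext => w'; apply: (Hh [::]).
by rewrite !IH //; apply: proj_inv_cons.
Qed.

Section Commutator.
Variables (K : fieldType) (V U : lmodType K).
Implicit Types (h g : seq (letter V) -> V) (phi : seq (letter V) -> U).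

(* Both [h] and [g] are inserted, neither into the other. *)
Fixpoint ins2 (d m : bool) h (c l : bool) g phi (w : seq (letter V)) : U :=
  if w is x :: w' then
    (-1) ^+ ((m (+) l) && par x) *: ins2 d m h c l g (fun u => phi (x :: u)) w'
    + (-1) ^+ (m && par x) *: ins2 d m h c (l (+) par x) (fun u => g (x :: u)) phi w'
    + ins2 d (m (+) par x) (fun u => h (x :: u)) c l g phi w'
  else (-1) ^+ (m && l) *: phi [:: lab d m (h [::]); lab c l (g [::])].

(** The value of [h] is the last letter offered to [g]. If it is kept, [g] passes it, whence the
    sign [(-1) ^+ (m && l)] ending [ins2]; if it is absorbed, the map inserted into [phi] is
    [ins d m h g], of parity [m (+) l]. *)
Lemma ins_ins d m h c l g phi w : multilin phi ->
  ins d m h (ins c l g phi) w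
  = ins2 d m h c l g phi w + ins c (m (+) l) (ins d m h g) phi w.
Proof.
elim: w m h l g phi => [|x w IH] m h l g phi H /=.
  by rewrite [l && _]andbC [l (+) m]addbC.
rewrite ins_Dr ins_Zr ins_Dl // ins_Zl // !IH //; last exact: multilin_cons.
rewrite addbA addbAC; lmod_signs K U.
Qed.

(** At the end of the word the two inserted letters are exchanged in [phi]. Along the word, the
    change of [m && l] when one map absorbs a letter offsets the sign for passing the other map. *)
Lemma ins2_sym d m h c l g phi w : supersym phi ->
  ins2 d m h c l g phi w = (-1) ^+ (m && l) *: ins2 c l g d m h phi w.
Proof.
elim: w m h l g phi => [|x w IH] m h l g phi H /=.
  rewrite (H [::]) /= !parE; lmod_signs K U.
rewrite (IH m h l) ?(IH m h (l (+) par x)) ?(IH (m (+) par x)) //; last exact: supersym_cons.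
lmod_signs K U.
Qed.

End Commutator.

(** * Recolouring and the pre-Lie identity on words *)

Section PreLie.
Variables (K : fieldType) (V : lmodType K).
Implicit Types (f g h phi : seq (letter V) -> V).

(** This is [phi] composed with S(T), where T is the idempotent of V (+) V that sends a vector of
    colour [false] to the sum of its two copies and a vector of colour [true] to 0. *)
Fixpoint recolor phi (w : seq (letter V)) : V :=
  if w is x :: w' then
    if color x then 0
    else recolor (fun u => phi ((false, x.2) :: u)) w'
         + recolor (fun u => phi ((true, x.2) :: u)) w'
  else phi [::].

Lemma recolor_ZD a phi psi w :
  recolor (fun u => a *: phi u + psi u) w = a *: recolor phi w + recolor psi w.
Proof.
elim: w phi psi => //= -[[] l] w IH phi psi /=; first by rewrite scaler0 addr0.
rewrite !IH; lmod_signs K V.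
Qed.

Lemma recolor_D phi psi w :
  recolor (fun u => phi u + psi u) w = recolor phi w + recolor psi w.
Proof.
elim: w phi psi => //= -[[] l] w IH phi psi /=; first by rewrite addr0.
rewrite !IH; lmod_signs K V.
Qed.

Lemma recolor_Z a phi w : recolor (fun u => a *: phi u) w = a *: recolor phi w.
Proof.
elim: w phi => //= -[[] l] w IH phi /=; first by rewrite scaler0.
by rewrite !IH scalerDr.
Qed.

Lemma recolor_0 w : recolor (fun _ => 0) w = 0.
Proof. by elim: w => //= -[[] l] w IH //=; rewrite IH addr0. Qed.

Lemma recolor_colored phi u x w : color x -> recolor phi (u ++ x :: w) = 0.
Proof.
move=> cx; elim: u phi => [|y u IH] phi /=; first by rewrite cx.
by case: ifP => // _; rewrite !IH addr0.
Qed.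

Lemma recolor_multilin phi : multilin phi -> multilin (recolor phi).
Proof.
move=> H u; elim: u phi H => [|x u IH] phi H c b a v v' w /=.
  case: c => /=; first by rewrite scaler0 addr0.
  have E c : (fun w => phi (lab c b (a *: v + v') :: w))
    = (fun w => a *: phi (lab c b v :: w) + phi (lab c b v' :: w)).
    by apply/funext => w'; apply: (H [::]).
  rewrite -!/(lab _ _ _) !E !recolor_ZD; lmod_signs K V.
case: ifP => _; first by rewrite scaler0 addr0.
rewrite !IH; try exact: multilin_cons.
lmod_signs K V.
Qed.

Lemma recolor_supersym phi : supersym phi -> supersym (recolor phi).
Proof.
move=> H u; elim: u phi H => [|x u IH] phi H y z w /=.
  case: (color y); case: (color z); rewrite /= ?addr0 ?scaler0 //.
  have E c d : (fun w => phi [:: (c, y.2), (d, z.2) & w])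
    = (fun w => (-1) ^+ (par y && par z) *: phi [:: (d, z.2), (c, y.2) & w]).
    by apply/funext => w'; apply: (H [::]).
  rewrite !E !recolor_Z; lmod_signs K V.
case: ifP => _; first by rewrite scaler0.
rewrite (IH (fun u => phi ((false, x.2) :: u)))
  ?(IH (fun u => phi ((true, x.2) :: u)) _ y z) ?scalerDr //;
  exact: supersym_cons.
Qed.

Lemma recolor_proj_inv pi phi : proj_inv pi phi -> proj_inv pi (recolor phi).
Proof.
move=> H u; elim: u phi H => [|x u IH] phi H c b v w /=.
  case: ifP => // _.
  have E d : (fun w => phi (lab d b (pi b v) :: w)) = (fun w => phi (lab d b v :: w)).
    by apply/funext => w'; apply: (H [::]).
  by rewrite !E.
by case: ifP => // _; rewrite !IH //; apply: proj_inv_cons.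
Qed.

Definition extend phi (c : bool) : seq (letter V) -> V :=
  if c then phi else recolor phi.

Definition coder_act k (G : bool -> seq (letter V) -> V) phi w : V :=
  ins false k (G false) phi w + ins true k (G true) phi w.

Definition precomp l f g := coder_act l (extend g) f.

(** The inserted letter has colour [true], which recolouring sends to 0. *)
Lemma ins_recolor k g f w : multilin f ->
  ins true k g (recolor f) w = 0.
Proof.
move=> Mf.
(* The induction runs over all multilinear functions vanishing on words with a letter of colour
   [true], a class closed under fixing the first letter. *)
have: forall u x w', color x -> recolor f (u ++ x :: w') = 0.
  by move=> *; apply: recolor_colored.
have := recolor_multilin Mf.
elim: w k g (recolor f) => [|x w IH] k g phi M H /=; first exact: (H [::]).
rewrite !IH ?scaler0 ?addr0 //; first exact: multilin_cons.
by move=> u; apply: (H (x :: u)).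
Qed.

(** In colour [false] this says that S(T) commutes with D_g. T sends the pair of values
    ([recolor g], [g]) to ([recolor g], [recolor g]), and D_g produces the same pair from recoloured
    arguments because T is idempotent. *)
Lemma act_extend k g f c w : multilin f ->
  coder_act k (extend g) (extend f c) w = extend (coder_act k (extend g) f) c w.
Proof.
case: c => //= Mf.
rewrite /coder_act /= ins_recolor // addr0.
elim: w k g f Mf => [|[[] l] w IH] k g f Mf //=.
  rewrite ins_0r scaler0 add0r ins_0l //; exact: recolor_multilin.
have Mf' := fun d => multilin_cons (d, l) Mf.
rewrite ins_Dr ins_Dl; last exact: recolor_multilin.
rewrite (IH k g) ?(IH k g (fun u => f ((true, l) :: u))) //.
rewrite (IH _ (fun u => g ((false, l) :: u))) //.
rewrite (IH _ (fun u => g ((true, l) :: u))) //.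
rewrite -![par (true, l)]/(par (false, l)) !recolor_D !recolor_Z.
have ED k' A B : recolor (fun u => ins false k' (fun u => A u + B u) f u) w
  = recolor (ins false k' A f) w + recolor (ins false k' B f) w.
  by rewrite -recolor_D; congr recolor; apply/funext => u; apply: ins_Dl.
(* These are the terms in which a letter already recoloured to [true] enters [recolor g], which then
   vanishes. *)
have E0 k' : recolor (fun u => ins false k' (fun _ => 0) f u) w = 0.
  rewrite -[RHS](recolor_0 w); congr recolor.
  by apply/funext => u; apply: ins_0l.
rewrite (ED _ (recolor (fun u => g ((false, l) :: u)))
               (recolor (fun u => g ((true, l) :: u)))) E0; lmod_signs K V.
Qed.

Lemma comp_ZDl l a f f' g w :
  precomp l (fun u => a *: f u + f' u) g w = a *: precomp l f g w + precomp l f' g w.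
Proof. rewrite /precomp /coder_act !ins_ZDr; lmod_signs K V. Qed.

Lemma comp_ZDr l a f g g' w : multilin f ->
  precomp l f (fun u => a *: g u + g' u) w = a *: precomp l f g w + precomp l f g' w.
Proof.
move=> Mf; rewrite /precomp /coder_act /extend.
have -> : recolor (fun u => a *: g u + g' u)
  = (fun u => a *: recolor g u + recolor g' u).
  by apply/funext => u; apply: recolor_ZD.
rewrite !ins_ZDl //; lmod_signs K V.
Qed.

Lemma comp_multilin l f g : multilin f -> multilin g -> multilin (precomp l f g).
Proof.
move=> Mf Mg u c b a v v' w; rewrite /precomp /coder_act !ins_multilin //;
  last exact: recolor_multilin.
lmod_signs K V.
Qed.

Lemma comp_supersym l f g : multilin f -> supersym f -> supersym g ->
  supersym (precomp l f g).
Proof.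
move=> Mf Sf Sg u x y w; rewrite /precomp /coder_act /=.
rewrite (@ins_supersym _ _ _ _ _ _ _ Mf (recolor_supersym Sg) Sf u x y).
rewrite (@ins_supersym _ _ _ _ _ _ _ Mf Sg Sf u x y).
lmod_signs K V.
Qed.

Lemma comp_proj_inv pi l f g : proj_inv pi f -> proj_inv pi g ->
  proj_inv pi (precomp l f g).
Proof.
move=> If Ig u c b v w; rewrite /precomp /coder_act !(ins_proj_inv _ _ _ If) //.
exact: recolor_proj_inv.
Qed.

Lemma comp_prelie l m f g h w : multilin f -> supersym f -> multilin g ->
  multilin h ->
  precomp m (precomp l f g) h w - precomp (m (+) l) f (precomp m g h) w
  = (-1) ^+ (m && l) *:
    (precomp l (precomp m f h) g w - precomp (m (+) l) f (precomp l h g) w).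
Proof.
move=> Mf Sf Mg Mh.
have E m' l' h' g' : multilin g' -> precomp m' (precomp l' f g') h' w
    - precomp (m' (+) l') f (precomp m' g' h') w
  = (ins2 false m' (recolor h') false l' (recolor g') f w
     + ins2 false m' (recolor h') true l' g' f w)
  + (ins2 true m' h' false l' (recolor g') f w + ins2 true m' h' true l' g' f w).
  move=> Mg'; rewrite /precomp /coder_act !ins_Dr !ins_ins // /=.
  (* By [act_extend] the value of colour [false] of the inner product is [recolor g'] composed with
     the coderivation of [h'], so the nested terms of [ins_ins] cancel in both colours. *)
  have -> : recolor (fun u => ins false m' (recolor h') g' u + ins true m' h' g' u)
    = (fun u => ins false m' (recolor h') (recolor g') u
                + ins true m' h' (recolor g') u).
    by apply/funext => u; have := act_extend m' h' false u Mg'; rewrite /coder_act /= => ->.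
  rewrite !ins_Dl //; lmod_signs K V.
rewrite E // [in RHS]addbC E //.
(* The exchange preserves the two terms with equal colours and swaps the two mixed ones. *)
rewrite !(ins2_sym _ m _ _ l); try exact: Sf.
lmod_signs K V.
Qed.

End PreLie.

(** * Parity and degree *)

Section ParityProjections.

Definition oddz (i : int) : bool := odd `|i|%N.

Lemma signzE (K : fieldType) (i : int) : (-1 : K) ^ i = (-1) ^+ oddz i.
Proof. by rewrite /oddz signr_odd; case: i => [n|n] //=; rewrite /exprz invr_sign. Qed.

Lemma oddzM i j : oddz (i * j) = oddz i && oddz j.
Proof. by rewrite /oddz abszM oddM. Qed.

(** Read off from the multiplicativity of powers of -1 in the rationals, where the two parities give
    different signs. *)
Lemma oddzD i j : oddz (i + j) = oddz i (+) oddz j.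
Proof.
apply: (@Num.Theory.signr_inj rat) => /=.
by rewrite signr_addb -!signzE expfzDr // oppr_eq0 oner_eq0.
Qed.

Variables (K : fieldType) (V : lmodType K) (D : int -> V -> Prop).
Hypothesis gradV : is_grading D.

Let parity_space (b : bool) := lspan (fun v => exists2 i, oddz i = b & D i v).

Lemma grading_linear_comb i a x y : D i x -> D i y -> D i (a *: x + y).
Proof. by case: gradV => H _ _; apply: (H i).2. Qed.

(** A combination may repeat degrees; merging equal ones gives the indexed form required by the
    independence clause of [is_grading]. *)
Lemma parity_space_sum b v : parity_space b v ->
  exists s (x : int -> V), [/\ uniq s, forall i, D i (x i),
    forall i, i \in s -> oddz i = b & v = \sum_(i <- s) x i].
Proof.
have D0 i : D i 0 by case: gradV => H _ _; apply: (H i).1.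
elim=> [|a x y [i ib Dx] _ [s [z [us Dz sb ->]]]].
  by exists [::], (fun _ => 0); split=> //; rewrite big_nil.
pose z' j := if j == i then a *: x + (if i \in s then z i else 0) else z j.
have Dz' j : D j (z' j).
  rewrite /z'; case: eqP => [->|_] //; apply: grading_linear_comb => //.
  by case: ifP.
have [si|si] := boolP (i \in s).
  exists s, z'; split=> //; rewrite !(bigD1_seq i) //= {1}/z' eqxx si addrA.
  congr (_ + _); rewrite big_seq_cond [RHS]big_seq_cond.
  by apply: eq_bigr => j /andP[_ /negPf ji]; rewrite /z' ji.
exists (i :: s), z'; split=> //; first by rewrite /= si.
  by move=> j; rewrite inE => /predU1P[->|/sb].
rewrite big_cons {1}/z' eqxx (negPf si) addr0; congr (_ + _).
by apply: eq_big_seq => j js; rewrite /z'; case: eqP js si => // -> ->.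
Qed.

(** The two lists of degrees are disjoint by parity, so their concatenation has no repetition and
    independence applies to the merged family [z]. *)
Lemma parity_space_disjoint u v :
  parity_space false u -> parity_space true v -> u + v = 0 -> u = 0 /\ v = 0.
Proof.
move=> /parity_space_sum[s [x [us Dx sb ->]]] /parity_space_sum[t [y [ut Dy tb ->]]].
pose z i := if oddz i then y i else x i.
have -> : \sum_(i <- s) x i = \sum_(i <- s) z i.
  by apply: eq_big_seq => i /sb; rewrite /z => ->.
have -> : \sum_(i <- t) y i = \sum_(i <- t) z i.
  by apply: eq_big_seq => i /tb; rewrite /z => ->.
rewrite -big_cat => st0; case: gradV => _ _ /(_ (s ++ t) z) H.
have {}H i : i \in s ++ t -> z i = 0.
  apply: H => // [|j]; last by rewrite /z; case: ifP.
  rewrite cat_uniq us ut andbT; apply/hasPn => j /tb jt; apply/negP => /sb.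
  by rewrite jt.
by rewrite !big_seq !big1 // => i it; apply: H; rewrite mem_cat it ?orbT.
Qed.

(** Only the coarsening of the grading to even and odd parts is given projections, since the signs
    depend on nothing finer. *)
Definition parity_proj (pi : bool -> V -> V) : Prop :=
  [/\ forall b, linear (pi b), forall v, pi false v + pi true v = v,
      forall b v, lspan (fun u => exists2 i, oddz i = b & D i u) (pi b v)
    & forall b i v, D i v -> pi b v = if b == oddz i then v else 0].

Lemma parity_proj_exists : exists pi, parity_proj pi.
Proof.
have split_ex v : exists p : V * V,
    [/\ parity_space false p.1, parity_space true p.2 & p.1 + p.2 = v].
  case: gradV => _ /(_ v) + _; elim=> [|a x y [i Dx] _ [[u w] /= [Hu Hw <-]]].
    by exists (0, 0); split; rewrite ?addr0 //; apply: lspan0.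
  case ib: (oddz i).
    exists (u, a *: x + w); split=> //=; last by rewrite addrCA.
    by apply: lspanS => //; exists i.
  exists (a *: x + u, w); split=> //=; last by rewrite addrA.
  by apply: lspanS => //; exists i.
pose p v := projT1 (cid (split_ex v)).
have pP v : [/\ parity_space false (p v).1, parity_space true (p v).2
    & (p v).1 + (p v).2 = v] by rewrite /p; case: cid.
(* The decomposition is picked by choice; its uniqueness makes the components linear in [v]. *)
have p_uniq v u w : parity_space false u -> parity_space true w -> u + w = v ->
    (p v).1 = u /\ (p v).2 = w.
  case: (pP v) => H1 H2 E Hu Hw E'.
  have H : ((p v).1 - u) + ((p v).2 - w) = 0 by rewrite addrACA -opprD E E' subrr.
  case: (parity_space_disjoint _ _ H) => [||/eqP + /eqP].
  - by apply: lspanD => //; rewrite -scaleN1r; apply: lspanZ.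
  - by apply: lspanD => //; rewrite -scaleN1r; apply: lspanZ.
  by rewrite !subr_eq0 => /eqP -> /eqP ->.
exists (fun b v => if b then (p v).2 else (p v).1); split.
- move=> b a u v.
  have [|||H1 H2] := p_uniq (a *: u + v) (a *: (p u).1 + (p v).1) (a *: (p u).2 + (p v).2).
  + by apply: lspanD; [apply: lspanZ|]; case: (pP u); case: (pP v).
  + by apply: lspanD; [apply: lspanZ|]; case: (pP u); case: (pP v).
  + by rewrite addrACA -scalerDr; case: (pP u) => _ _ ->; case: (pP v) => _ _ ->.
  by case: b.
- by move=> v; case: (pP v).
- by move=> b v; case: (pP v); case: b.
move=> b i v Dv.
have P0 c : parity_space c 0 by apply: lspan0.
have Pv c : oddz i = c -> parity_space c v by move=> ic; apply: sub_lspan; exists i.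
case ib: (oddz i).
  have [|||-> ->] := p_uniq v 0 v; rewrite ?add0r //; first exact: Pv.
  by case: b.
have [|||-> ->] := p_uniq v v 0; rewrite ?addr0 //; first exact: Pv.
by case: b.
Qed.

End ParityProjections.

Section HomogeneousWords.
Variables (K : fieldType) (V : lmodType K) (D : int -> V -> Prop).
Hypothesis gradV : is_grading D.
Variable pi : bool -> V -> V.
Hypothesis piP : parity_proj D pi.
Implicit Types (f g h phi : seq (letter V) -> V).

Inductive letters_deg : int -> seq (letter V) -> Prop :=
| letters_deg0 : letters_deg 0 [::]
| letters_degS i d c v w : D i v -> letters_deg d w ->
    letters_deg (i + d) (lab c (oddz i) v :: w).

Lemma proj0 b : pi b 0 = 0.
Proof.
case: piP => /(_ b) H _ _ _; have := H (-1) 0 0.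
by rewrite scaler0 addr0 scaleN1r addNr.
Qed.

Lemma projK b c v : pi b (pi c v) = if b == c then pi c v else 0.
Proof.
case: (piP) => Hlin _ /(_ c v) + Hhom.
elim=> [|a x y [i ic Dx] _ IH]; first by rewrite proj0; case: ifP.
by rewrite Hlin IH (Hhom _ _ _ Dx) ic; case: ifP; rewrite ?scaler0 ?addr0.
Qed.

(** Each letter can be projected to its labelled parity and then expanded into homogeneous vectors
    of that parity, so only homogeneous words with correct labels need to be tested. *)
Lemma multilin_ext phi psi : multilin phi -> multilin psi ->
  proj_inv pi phi -> proj_inv pi psi ->
  (forall d w, letters_deg d w -> phi w = psi w) -> phi = psi.
Proof.
move=> Mphi Mpsi Pphi Ppsi H; apply/funext => w.
elim: w phi psi Mphi Mpsi Pphi Ppsi H => [|[c [b v]] w IH] phi psi Mphi Mpsi Pphi Ppsi H.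
  exact/H/letters_deg0.
rewrite -/(lab c b v) -(Pphi [::]) -(Ppsi [::]) /=.
case: piP => _ _ /(_ b v) + _; elim=> [|a x y [i <- Dx] _ IHy].
  by rewrite (multilin0 [::]) ?(multilin0 [::]).
rewrite (Mphi [::]) (Mpsi [::]) IHy; congr (_ *: _ + _).
apply: (IH (fun u => phi (lab c (oddz i) x :: u))
           (fun u => psi (lab c (oddz i) x :: u)));
  do ?[exact: multilin_cons | exact: proj_inv_cons].
by move=> d u Du; apply/H/letters_degS/Du.
Qed.

Definition words_hom (k : int) phi : Prop :=
  forall d w, letters_deg d w -> D (d + k) (phi w).

Lemma words_hom_cons k phi i c v : words_hom k phi -> D i v ->
  words_hom (k + i) (fun w => phi (lab c (oddz i) v :: w)).
Proof.
move=> H Dv d w Dw; rewrite addrA addrAC [_ + i]addrC.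
exact/H/letters_degS.
Qed.

Let DZD := grading_linear_comb gradV.
Lemma grading0 i : D i 0.
Proof. by case: gradV => H _ _; apply: (H i).1. Qed.
Lemma gradingZ i a x : D i x -> D i (a *: x).
Proof. by move=> Dx; rewrite -[_ *: _]addr0; apply: DZD => //; apply: grading0. Qed.
Lemma gradingD i x y : D i x -> D i y -> D i (x + y).
Proof. by move=> Dx Dy; rewrite -[x]scale1r; apply: DZD. Qed.

Lemma ins_hom k l c h phi : words_hom l h -> words_hom k phi ->
  words_hom (k + l) (ins c (oddz l) h phi).
Proof.
move=> Hh Hphi d w Dw.
elim: Dw k l h phi Hh Hphi => {d w} [|i d c' v w Dv Dw IH] k l h phi Hh Hphi /=.
  have H0 : D l (h [::]) by rewrite -[l]add0r; apply/Hh/letters_deg0.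
  rewrite add0r addrC -[l in D (l + k)]addr0.
  exact/Hphi/letters_degS/letters_deg0.
rewrite parE -oddzD; apply: DZD.
  rewrite (_ : i + d + (k + l) = d + (k + i + l)); last by ring.
  exact/IH/words_hom_cons.
rewrite (_ : i + d + (k + l) = d + (k + (l + i))); last by ring.
by apply: IH => //; apply: words_hom_cons.
Qed.

(** On a homogeneous word the value of [h] has parity [oddz l] plus that of the absorbed letters.
    The label claims the opposite parity, and the corresponding component is 0. *)
Lemma ins_wrong_parity l c h phi : multilin h -> proj_inv pi h ->
  multilin phi -> proj_inv pi phi -> words_hom l h ->
  ins c (~~ oddz l) h phi = fun _ => 0.
Proof.
move=> Mh Ph Mphi Pphi Hh; apply: multilin_ext.
- exact: ins_multilin.
- by move=> u c' b a v v' w; rewrite scaler0 addr0.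
- exact: ins_proj_inv.
- by [].
move=> d w Dw.
elim: Dw l h phi Mh Ph Mphi Pphi Hh
  => {d w} [|i d c' v w Dv Dw IH] l h phi Mh Ph Mphi Pphi Hh /=.
  have H0 : D l (h [::]) by rewrite -[l]add0r; apply/Hh/letters_deg0.
  case: (piP) => _ _ _ /(_ (~~ oddz l) _ _ H0).
  rewrite -(Pphi [::]) => ->; case: (oddz l); exact: (multilin0 [::]).
rewrite parE addNb -oddzD !IH ?scaler0 ?addr0 //;
  by [exact: multilin_cons | exact: proj_inv_cons | exact: words_hom_cons].
Qed.

Lemma recolor_hom k phi : words_hom k phi -> words_hom k (recolor phi).
Proof.
move=> H d w Dw.
elim: Dw k phi H => {d w} [|i d c' v w Dv Dw IH] k phi H /=.
  exact/H/letters_deg0.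
case: ifP => _; first exact: grading0.
rewrite (_ : i + d + k = d + (k + i)); last by ring.
by apply: gradingD; apply: IH; apply: words_hom_cons.
Qed.

Lemma comp_hom k l f g : words_hom k f -> words_hom l g ->
  words_hom (k + l) (precomp (oddz l) f g).
Proof.
move=> Hf Hg d w Dw; apply: gradingD; apply: ins_hom => //.
exact: recolor_hom.
Qed.

Lemma comp_wrong_parity l f g : multilin f -> proj_inv pi f ->
  multilin g -> proj_inv pi g -> words_hom l g ->
  precomp (~~ oddz l) f g = fun _ => 0.
Proof.
move=> Mf Pf Mg Pg Hg; apply/funext => w; rewrite /precomp /coder_act /= !ins_wrong_parity ?addr0 //.
- exact: recolor_multilin.
- exact: recolor_proj_inv.
- exact: recolor_hom.
Qed.

(** Vanishing on words without the colour [true] encodes that the second factor is Sbar(V). If the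
    inserted letter has colour [false], [f] still sees no letter of colour [true]; otherwise the
    letter is a value of [g] on such a word, hence 0. *)
Lemma comp_colored l f g w :
  multilin f -> multilin g -> (forall w, ~~ has (@color K V) w -> f w = 0) ->
  (forall w, ~~ has (@color K V) w -> g w = 0) ->
  ~~ has (@color K V) w -> precomp l f g w = 0.
Proof.
move=> Mf Mg f0 g0 w0; rewrite /precomp /coder_act /=.
have -> : ins false l (recolor g) f w = 0.
  elim: w l (recolor g) f Mf f0 w0 {Mg g0} => [|x w IH] l h f' Mf f0 /= w0; first exact: f0.
  move: w0; rewrite negb_or => /andP[x0 w0].
  rewrite !IH ?scaler0 ?addr0 //; first exact: multilin_cons.
  by move=> u u0; rewrite f0 //= (negPf x0).
rewrite add0r.
elim: w l g f Mf f0 Mg g0 w0 => [|x w IH] l h f' Mf f0 Mh h0 /= w0.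
  by rewrite h0 // (multilin0 [::]).
move: w0; rewrite negb_or => /andP[x0 w0].
rewrite !IH ?scaler0 ?addr0 //.
- exact: multilin_cons.
- by move=> u u0; rewrite h0 //= (negPf x0).
- exact: multilin_cons.
- by move=> u u0; rewrite f0 //= (negPf x0).
Qed.

End HomogeneousWords.

(** * Maps out of the symmetric algebra *)

Section FreeModule.
Variables (K : fieldType) (S : choiceType) (U : lmodType K).

Definition malg_ext (phi : S -> U) (g : {malg K[S]}) : U :=
  \sum_(k <- msupp g) g@_k *: phi k.

Lemma malg_ext_widen phi g (A : {fset S}) : (msupp g `<=` A)%fset ->
  malg_ext phi g = \sum_(k <- A) g@_k *: phi k.
Proof.
move=> gA; apply: big_fset_incl => // k _ kg.
by rewrite mcoeff_outdom ?scale0r.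
Qed.

Lemma malg_ext_linear phi : linear (malg_ext phi).
Proof.
move=> a x y; pose A := (msupp x `|` msupp y)%fset.
rewrite !(@malg_ext_widen phi _ A) ?fsubsetUl ?fsubsetUr //; last first.
  apply: fsubset_trans (msuppD_le _ _) (fsetUSS _ (fsubset_refl _)).
  exact: msuppZ_le.
rewrite scaler_sumr -big_split; apply: eq_bigr => k _.
by rewrite mcoeffD mcoeffZ scalerDl scalerA.
Qed.

Lemma malg_extU phi k : malg_ext phi << k >> = phi k.
Proof.
by rewrite (malg_ext_widen _ msuppU_le) big_seq_fset1 mcoeffUU scale1r.
Qed.

Lemma malg_ext_ZD a (phi psi : S -> U) (g : {malg K[S]}) :
  malg_ext (fun k => a *: phi k + psi k) g = a *: malg_ext phi g + malg_ext psi g.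
Proof.
rewrite scaler_sumr -big_split; apply: eq_bigr => k _.
by rewrite scalerDr !scalerA mulrC.
Qed.

Lemma malg_lspan (g : {malg K[S]}) : lspan (fun x => exists k, x = << k >>) g.
Proof.
rewrite [g]monalgE; elim/big_ind: _ => [|x y|k _]; [exact: lspan0|exact: lspanD|].
have -> : << g@_k *g k >> = g@_k *: << k >>.
  by apply/malgP => k'; rewrite mcoeffZ !mcoeffU mulrnAr mulr1.
by apply: lspanZ; apply: sub_lspan; exists k.
Qed.

End FreeModule.

Section LinearMaps.
Variables (K : fieldType) (A U : lmodType K) (F : A -> U).
Hypothesis lF : linear F.

Lemma linear_fun0 : F 0 = 0.
Proof. by have := lF (-1) 0 0; rewrite scaler0 addr0 scaleN1r addNr. Qed.
Lemma linear_funD x y : F (x + y) = F x + F y.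
Proof. by rewrite -[x in LHS]scale1r lF scale1r. Qed.
Lemma linear_funZ a x : F (a *: x) = a *: F x.
Proof. by rewrite -[_ *: x]addr0 lF linear_fun0 addr0. Qed.
Lemma linear_funN x : F (- x) = - F x.
Proof. by rewrite -scaleN1r linear_funZ scaleN1r. Qed.
Lemma linear_funB x y : F (x - y) = F x - F y.
Proof. by rewrite linear_funD linear_funN. Qed.
Lemma linear_fun_sum (I : Type) (r : seq I) (P : pred I) (E : I -> A) :
  F (\sum_(i <- r | P i) E i) = \sum_(i <- r | P i) F (E i).
Proof. exact: (big_morph _ linear_funD linear_fun0). Qed.

Variable (G : A -> Prop).

Lemma lspan_ker x : (forall y, G y -> F y = 0) -> lspan G x -> F x = 0.
Proof.
move=> G0; elim=> [|a u v /G0 Fu _ Fv]; first exact: linear_fun0.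
by rewrite lF Fu Fv scaler0 addr0.
Qed.

Lemma lspan_linear (P : U -> Prop) x :
  P 0 -> (forall a u v, P u -> P v -> P (a *: u + v)) ->
  (forall y, G y -> P (F y)) -> lspan G x -> P (F x).
Proof.
move=> P0 PD PG; elim=> [|a u v /PG Fu _ Fv]; first by rewrite linear_fun0.
by rewrite lF; apply: PD.
Qed.

Lemma modspan_extE x : (forall y, G y -> F y = 0) ->
  F (repr (modspan_pi G x)) = F x.
Proof.
move=> G0; apply/eqP; rewrite -subr_eq0 -linear_funB; apply/eqP.
apply: lspan_ker G0 _; apply/asboolP.
by have /eqP := modspan_reprK (modspan_pi G x); rewrite -Quotient.idealrBE.
Qed.

Lemma modspan_ext_linear : (forall y, G y -> F y = 0) ->
  linear (fun x : modspan G => F (repr x)).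
Proof.
move=> G0 a x y.
rewrite -[in LHS](modspan_reprK x) -[in LHS](modspan_reprK y).
by rewrite -[_ *: _ + _]modspan_pi_linear modspan_extE // lF.
Qed.

End LinearMaps.

Lemma malg_ext_lincomb (K : fieldType) (S : choiceType) (U : lmodType K)
    (phi : S -> U) a k k1 k2 : phi k = a *: phi k1 + phi k2 ->
  malg_ext phi (<< k >> - (a *: << k1 >> + << k2 >>)) = 0.
Proof.
move=> E; pose L := malg_ext_linear phi.
rewrite (linear_funB L) (linear_funD L) (linear_funZ L) !malg_extU.
by rewrite E subrr.
Qed.

Section SymExtension.
Variables (K : fieldType) (V : lmodType K) (D : int -> V -> Prop).

Definition word_multilin (U : lmodType K) (phi : seq V -> U) : Prop :=
  forall w a u v w', phi (w ++ (a *: u + v) :: w') =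
    a *: phi (w ++ u :: w') + phi (w ++ v :: w').

Definition word_sym (U : lmodType K) (phi : seq V -> U) : Prop :=
  forall i j u v w w', D i u -> D j v ->
    phi (w ++ [:: u, v & w']) = (-1) ^ (i * j) *: phi (w ++ [:: v, u & w']).

Lemma mon_multilin : word_multilin (mon D).
Proof.
move=> w a u v w'; apply/eqP; rewrite -subr_eq0 /mon -linearZ -linearD -linearB.
apply/eqP; rewrite -[RHS](linear0 (modspan_pi (sym_rel D))).
exact/modspan_rel/sym_rel_lin.
Qed.

Lemma mon_sym : word_sym (mon D).
Proof.
move=> i j u v w w' Du Dv; apply/eqP; rewrite -subr_eq0 /mon -linearZ -linearB.
apply/eqP; rewrite -[RHS](linear0 (modspan_pi (sym_rel D))).
exact/modspan_rel/sym_rel_comm.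
Qed.

Section Ext.
Variables (U : lmodType K) (phi : seq V -> U).

(** Evaluating at a chosen representative makes sense for every [phi] and is linear in [phi];
    linearity in [x] and the values on monomials come from the invariance of [phi]. *)
Definition sym_ext (x : sym D) : U := malg_ext phi (repr x).

Hypotheses (Mphi : word_multilin phi) (Sphi : word_sym phi).

Lemma sym_rel_ker g : sym_rel D g -> malg_ext phi g = 0.
Proof.
pose L := malg_ext_linear phi.
by case=> [a u v w w'|i j u v w w' Du Dv];
  rewrite (linear_funB L) ?(linear_funD L) (linear_funZ L) !malg_extU
    ?Mphi -?(Sphi _ _ Du Dv) subrr.
Qed.

Lemma sym_ext_linear : linear sym_ext.
Proof. exact: (modspan_ext_linear (malg_ext_linear phi) sym_rel_ker). Qed.

Lemma sym_extE w : sym_ext (mon D w) = phi w.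
Proof.
rewrite /sym_ext /mon (modspan_extE (malg_ext_linear phi)) ?malg_extU //.
exact: sym_rel_ker.
Qed.

End Ext.

Lemma sym_ext_ZD (U : lmodType K) a (phi psi : seq V -> U) x :
  sym_ext (fun w => a *: phi w + psi w) x = a *: sym_ext phi x + sym_ext psi x.
Proof. exact: malg_ext_ZD. Qed.

Lemma tens_linearl y : linear (fun x : sym D => tens x (y : symbar D)).
Proof.
move=> a x x'; apply/eqP; rewrite -subr_eq0 /tens -linearZ -linearD -linearB.
apply/eqP; rewrite -[RHS](linear0 (modspan_pi (@tensor_rel _ (sym D) (symbar D)))).
exact/modspan_rel/tensor_rell.
Qed.

Lemma tens_linearr x : linear (fun y : symbar D => tens (x : sym D) y).
Proof.
move=> a y y'; apply/eqP; rewrite -subr_eq0 /tens -linearZ -linearD -linearB.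
apply/eqP; rewrite -[RHS](linear0 (modspan_pi (@tensor_rel _ (sym D) (symbar D)))).
exact/modspan_rel/tensor_relr.
Qed.

Definition stens_ext (U : lmodType K) (F : seq V -> seq V -> U) (t : stens D) : U :=
  malg_ext (fun p : sym D * symbar D =>
    sym_ext (fun w => sym_ext (F w) (val p.2)) p.1) (repr t).

Lemma stens_ext_ZD (U : lmodType K) a (F F' : seq V -> seq V -> U) t :
  stens_ext (fun w w' => a *: F w w' + F' w w') t
  = a *: stens_ext F t + stens_ext F' t.
Proof.
rewrite /stens_ext -malg_ext_ZD; congr (malg_ext _ _); apply/funext => p.
by rewrite -sym_ext_ZD; congr (sym_ext _ _); apply/funext => w; rewrite sym_ext_ZD.
Qed.

Section StensExt.
Variables (U : lmodType K) (F : seq V -> seq V -> U).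

Definition biword : Prop :=
  [/\ forall w', word_multilin (F^~ w'), forall w', word_sym (F^~ w'),
      forall w, word_multilin (F w) & forall w, word_sym (F w)].

Hypothesis HF : biword.

Lemma sym_ext_multilin x : word_multilin (fun w => sym_ext (F w) x).
Proof.
move=> w a u v w'; rewrite -sym_ext_ZD; congr (sym_ext _ _); apply/funext => z.
by case: HF => H _ _ _; apply: (H z).
Qed.

Lemma sym_ext_sym x : word_sym (fun w => sym_ext (F w) x).
Proof.
move=> i j u v w w' Du Dv.
rewrite -[RHS]addr0 -[X in _ + X](_ : sym_ext (fun _ => 0) x = 0); last first.
  by rewrite /sym_ext /malg_ext big1 // => k _; rewrite scaler0.
rewrite -sym_ext_ZD; congr (sym_ext _ _); apply/funext => z.
by case: HF => _ H _ _; rewrite addr0; apply: (H z).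
Qed.

Let B (p : sym D * symbar D) : U :=
  sym_ext (fun w => sym_ext (F w) (val p.2)) p.1.

Lemma tensor_rel_ker g : tensor_rel g -> malg_ext B g = 0.
Proof.
have [_ _ M S] := HF.
case=> [a x x' y|a x y y']; apply: malg_ext_lincomb; rewrite /B /=.
  by apply: sym_ext_linear; [exact: sym_ext_multilin|exact: sym_ext_sym].
rewrite -sym_ext_ZD; congr (sym_ext _ _); apply/funext => w.
exact: sym_ext_linear.
Qed.

Lemma stens_ext_linear : linear (stens_ext F).
Proof. exact: (modspan_ext_linear (malg_ext_linear B) tensor_rel_ker). Qed.

Lemma stens_ext_tens x y :
  stens_ext F (tens x y) = sym_ext (fun w => sym_ext (F w) (val y)) x.
Proof.
rewrite /stens_ext /tens (modspan_extE (malg_ext_linear B)) ?malg_extU //.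
exact: tensor_rel_ker.
Qed.

Lemma stens_extE w w' : w' != [::] ->
  stens_ext F (tens (mon D w) (monbar D w')) = F w w'.
Proof.
have [_ _ M S] := HF.
move=> w'0; rewrite stens_ext_tens val_monbar // sym_extE; first exact: sym_extE.
- exact: sym_ext_multilin.
- exact: sym_ext_sym.
Qed.

End StensExt.
End SymExtension.

(** * Homogeneous tensors and the grading of the space of maps *)

Section HomogeneousTensors.
Variables (K : fieldType) (V : lmodType K) (D : int -> V -> Prop).
Hypothesis gradV : is_grading D.

Lemma lspan_sub (A : lmodType K) (G H : A -> Prop) x :
  (forall y, G y -> lspan H y) -> lspan G x -> lspan H x.
Proof.
move=> GH; elim=> [|a u v /GH Hu _ Hv]; first exact: lspan0.
by apply: lspanD => //; apply: lspanZ.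
Qed.

(** The length is recorded so that nonempty words expand into nonempty words, the only ones on which
    [monbar] is meaningful. *)
Lemma word_multilin_span (U : lmodType K) (phi : seq V -> U) w :
  word_multilin phi ->
  lspan (fun x => exists d w', [/\ word_deg D d w', size w' = size w & x = phi w'])
    (phi w).
Proof.
elim: w phi => [|v w IH] phi M.
  by apply: sub_lspan; exists 0, [::]; split=> //; apply: word_deg0.
have Mv u : word_multilin (fun w => phi (u :: w)) by move=> w0; apply: (M (u :: w0)).
have lin : linear (fun u => phi (u :: w)) by move=> a u u'; apply: (M [::]).
apply: (lspan_linear lin (P := lspan _)) (_ : lspan (fun u => exists i, D i u) v).
- exact: lspan0.
- by move=> a u u' Hu Hu'; apply: lspanD => //; apply: lspanZ.
- move=> u [i Du]; apply: lspan_sub (IH _ (Mv u)) => _ [d [w' [Dw' sw' ->]]].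
  apply: sub_lspan; exists (i + d), (u :: w'); split=> //=; last by rewrite sw'.
  exact: word_degS.
by case: gradV.
Qed.

Lemma sym_span (x : sym D) : lspan (fun y => exists w, y = mon D w) x.
Proof.
rewrite -[x]modspan_reprK.
apply: (lspan_linear (modspan_pi_linear (sym_rel D)) (P := lspan _)) (malg_lspan (repr x)).
- exact: lspan0.
- by move=> a u u' Hu Hu'; apply: lspanD => //; apply: lspanZ.
by move=> _ [w ->]; apply: sub_lspan; exists w.
Qed.

Lemma symbar_val_linear : linear (val : symbar D -> sym D).
Proof.
exact: (linearP (val : spanned (fun x : sym D => exists2 n, (0 < n)%N & sympow n x)
  -> sym D)).
Qed.

Lemma monbar_multilin w a u v w' :
  monbar D (w ++ (a *: u + v) :: w') =
    a *: monbar D (w ++ u :: w') + monbar D (w ++ v :: w').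
Proof.
have nz (x : V) : w ++ x :: w' != [::] by case: w.
by apply: val_inj; rewrite symbar_val_linear !val_monbar // mon_multilin.
Qed.

Lemma monbar_sym : word_sym D (monbar D).
Proof.
move=> i j u v w w' Du Dv.
have nz (x y : V) : w ++ [:: x, y & w'] != [::] by case: w.
by apply: val_inj; rewrite (linear_funZ symbar_val_linear) !val_monbar // (mon_sym _ _ Du Dv).
Qed.

Definition hom_tensor (t : stens D) : Prop :=
  exists d e w w', [/\ word_deg D d w, word_deg D e w', w' != [::]
    & t = tens (mon D w) (monbar D w')].

(** Sbar(V) is given by a span inside S(V), so each linear combination has to be lifted to the
    submodule: the outer induction is over the union of the powers, the inner one within a single
    power. *)
Lemma symbar_span (y : symbar D) : 
  lspan (fun y => exists e w, [/\ word_deg D e w, w != [::] & y = monbar D w]) y.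
Proof.
have: exists2 y' : symbar D, val y' = val y &
    lspan (fun y => exists e w, [/\ word_deg D e w, w != [::] & y = monbar D w]) y'.
  case: y => x /= /asboolP; elim=> [|a u v [n n0 Hu] _ [v' vE Hv]].
    by exists 0; [rewrite (linear_fun0 symbar_val_linear)|exact: lspan0].
  have {u Hu} [u' <- Hu'] : exists2 y' : symbar D, val y' = u &
      lspan (fun y => exists e w, [/\ word_deg D e w, w != [::] & y = monbar D w]) y'.
    elim: Hu => [|b p q [w sw ->] _ [q' qE Hq]].
      by exists 0; [rewrite (linear_fun0 symbar_val_linear)|exact: lspan0].
    have w0 : w != [::] by rewrite -size_eq0 sw -lt0n.
    exists (b *: monbar D w + q'); first by rewrite symbar_val_linear val_monbar //= qE.
    apply: lspanD Hq; apply: lspanZ.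
    apply: lspan_sub (word_multilin_span w monbar_multilin) => _ [e [w' [De sw' ->]]].
    apply: sub_lspan; exists e, w'; split=> //.
    by rewrite -size_eq0 sw' size_eq0.
  exists (a *: u' + v'); first by rewrite symbar_val_linear /= vE.
  by apply: lspanD => //; apply: lspanZ.
by case=> y' /val_inj ->.
Qed.

Lemma stens_span (t : stens D) : lspan hom_tensor t.
Proof.
rewrite -[t]modspan_reprK.
apply: (lspan_linear (modspan_pi_linear (@tensor_rel _ (sym D) (symbar D)))
  (P := lspan hom_tensor))
  (malg_lspan (repr t)).
- exact: lspan0.
- by move=> a u u' Hu Hu'; apply: lspanD => //; apply: lspanZ.
move=> _ [[x y] ->].
rewrite -[modspan_pi _ _]/(tens x y).
apply: (lspan_linear (tens_linearl y) (P := lspan hom_tensor)) (sym_span x).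
- exact: lspan0.
- by move=> a u u' Hu Hu'; apply: lspanD => //; apply: lspanZ.
move=> _ [w ->].
have M : word_multilin (fun w => tens (mon D w) y).
  by move=> u a v v' u'; rewrite mon_multilin (tens_linearl y).
apply: lspan_sub (word_multilin_span w M) => _ [d [{}w [Dw _ ->]]].
apply: (lspan_linear (tens_linearr (mon D w)) (P := lspan hom_tensor)) (symbar_span y).
- exact: lspan0.
- by move=> a u u' Hu Hu'; apply: lspanD => //; apply: lspanZ.
by move=> _ [e [w' [Dw' w'0 ->]]]; apply: sub_lspan; exists d, e, w, w'.
Qed.

Lemma hom_tensor_deg t : hom_tensor t -> exists d, stens_deg d t.
Proof.
case=> d [e [w [w' [Dw Dw' w'0 ->]]]]; exists (d + e); apply: sub_lspan.
exists d, e, (mon D w), (monbar D w'); split=> //; apply: sub_lspan; first by exists w.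
by exists w'; rewrite ?val_monbar.
Qed.

Lemma linear_stens_ext (U : lmodType K) (F G : stens D -> U) :
  linear F -> linear G -> (forall t, hom_tensor t -> F t = G t) -> F = G.
Proof.
move=> lF lG FG; apply/funext => t; apply/eqP; rewrite -subr_eq0; apply/eqP.
apply: (@lspan_ker _ _ _ (fun t => F t - G t) _ hom_tensor t); last exact: stens_span.
  by move=> a x y; rewrite lF lG scalerBr opprD addrACA.
by move=> y /FG ->; rewrite subrr.
Qed.

(* The junk value of [monbar [::]] is avoided, so that the empty second word
   always gives [0]. *)
Definition eval_words (F : stens D -> V) (w w' : seq V) : V :=
  if w' is [::] then 0 else F (tens (mon D w) (monbar D w')).

Lemma eval_words_biword F : linear F -> biword D (eval_words F).
Proof.
move=> lF; split.
- move=> [|y w'] w a u v w0 /=; first by rewrite scaler0 addr0.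
  by rewrite mon_multilin (tens_linearl (monbar D (y :: w'))) lF.
- move=> [|y w'] i j u v w w0 Du Dv /=; first by rewrite scaler0.
  rewrite (mon_sym _ _ Du Dv) (linear_funZ (tens_linearl (monbar D (y :: w')))).
  by rewrite (linear_funZ lF).
- move=> w w1 a u v w2; rewrite /eval_words.
  case E: (w1 ++ (a *: u + v) :: w2) => [|z s]; first by case: w1 E.
  case Eu: (w1 ++ u :: w2) => [|z' s']; first by case: w1 Eu {E}.
  case Ev: (w1 ++ v :: w2) => [|z'' s'']; first by case: w1 Ev {E Eu}.
  by rewrite -E -Eu -Ev monbar_multilin (tens_linearr (mon D w)) lF.
move=> w i j u v w1 w2 Du Dv; rewrite /eval_words.
case E: (w1 ++ [:: u, v & w2]) => [|z s]; first by case: w1 E.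
case Eu: (w1 ++ [:: v, u & w2]) => [|z' s']; first by case: w1 Eu {E}.
rewrite -E -Eu (monbar_sym _ _ Du Dv) (linear_funZ (tens_linearr (mon D w))).
by rewrite (linear_funZ lF).
Qed.

Definition biword_deg (k : int) (F : seq V -> seq V -> V) : Prop :=
  forall d e w w', word_deg D d w -> word_deg D e w' -> D (d + e + k) (F w w').

Lemma stens_ext_deg k F : biword D F -> biword_deg k F -> hom_deg k (stens_ext (D := D) F).
Proof.
move=> B H; split; first exact: stens_ext_linear.
have D0 i : D i 0 := grading0 gradV i.
have DZD i a x y := @grading_linear_comb _ _ _ gradV i a x y.
move=> d t Dt; apply: (lspan_linear (stens_ext_linear B) (P := D (d + k))) Dt => //.
  by move=> a u v; apply: DZD.
intros z (a & b & x & y & [Dx Dy <- ->]); rewrite (stens_ext_tens B).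
have [_ _ M S] := B.
have Lx : linear (fun x : sym D => sym_ext (fun w => sym_ext (F w) (val y)) x).
  by apply: sym_ext_linear; [exact: sym_ext_multilin|exact: sym_ext_sym].
apply: (lspan_linear Lx (P := D _)) Dx => // [c u v|_ [w Dw ->]]; first exact: DZD.
rewrite sym_extE; [|exact: sym_ext_multilin|exact: sym_ext_sym].
apply: (lspan_linear (sym_ext_linear (M w) (S w)) (P := D _)) Dy => // [c u v|_ [w' Dw' ->]].
  exact: DZD.
by rewrite sym_extE //; apply: H.
Qed.

Lemma eval_words_deg k (F : stens D -> V) : hom_deg k F -> biword_deg k (eval_words F).
Proof.
move=> [lF H] d e w w' Dw Dw'; rewrite /eval_words; case: w' Dw' => [|v w'] Dw'.
  exact: grading0.
apply: H; apply: sub_lspan; exists d, e, (mon D w), (monbar D (v :: w')).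
by split=> //; apply: sub_lspan; [exists w|exists (v :: w') => //; rewrite val_monbar].
Qed.

Lemma gHom_val_linear : linear (val : gHom D -> (stens D -> V)).
Proof.
exact: (linearP (val : spanned (fun f : stens D -> V => exists k, hom_deg k f)
  -> (stens D -> V))).
Qed.

Lemma gHom_valZD a (x y : gHom D) t :
  val (a *: x + y) t = a *: val x t + val y t.
Proof. by rewrite gHom_val_linear. Qed.

Lemma gHom_grading : is_grading (@gHom_deg K V D).
Proof.
have D0 i : D i 0 := grading0 gradV i.
have gval_lin := gHom_val_linear.
have gval_sum (s : seq int) (x : int -> gHom D) t :
    val (\sum_(i <- s) x i) t = \sum_(i <- s) val (x i) t.
  rewrite (linear_fun_sum gval_lin).
  by elim: s => [|i s IH]; rewrite ?big_nil // !big_cons -IH.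
split.
- move=> k; split.
    rewrite /gHom_deg (linear_fun0 gval_lin); split=> [a x y|d t _]; last exact: D0.
    by rewrite scaler0 addr0.
  move=> a x y [lx Hx] [ly Hy]; rewrite /gHom_deg; split=> [b u v|d t Dt].
    by rewrite !gHom_valZD lx ly !scalerDr !scalerA [b * a]mulrC addrACA.
  by rewrite gHom_valZD; apply: grading_linear_comb => //; [apply: Hx|apply: Hy].
- move=> x.
  have: exists2 y : gHom D, val y = val x & lspan (fun y => exists i, gHom_deg i y) y.
    case: x => x /= /asboolP; elim=> [|a u v [k Hu] _ [v' vE Hv]].
      by exists 0; [rewrite (linear_fun0 gval_lin)|exact: lspan0].
    have up : u \in spanp (fun f : stens D -> V => exists k, hom_deg k f).
      by apply/asboolP/sub_lspan; exists k.
    exists (a *: (Spanned up : gHom D) + v'); first by rewrite gval_lin /= vE.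
    by apply: lspanS => //; exists k.
  by case=> y /val_inj ->.
move=> s x us Hx x0 i si; apply: val_inj; rewrite (linear_fun0 gval_lin).
have [li _] := Hx i.
apply: linear_stens_ext => // [a u v|t Ht]; first by rewrite scaler0 addr0.
have [d Dt] := hom_tensor_deg Ht.
have [_ _ indep] := gradV.
(* At a tensor of degree [d], the component of degree [i] takes its value in degree [d + i]; after
   this shift of indices, independence in [V] applies. *)
have {}x0 : \sum_(j <- [seq d + j | j <- s]) val (x (j - d)) t = 0.
  have := gval_sum s x t; rewrite x0 (linear_fun0 gval_lin) big_map -[X in X = _]/(0 : V) => H.
  rewrite [RHS]H; by apply: eq_bigr => j _; rewrite [d + j]addrC addrK.
have := indep _ _ _ _ x0 (d + i); rewrite [d + i]addrC addrK => -> //.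
- by rewrite map_inj_uniq //; apply: addrI.
- by move=> j; have [_ H] := Hx (j - d); have := H _ _ Dt; rewrite addrC subrK.
by rewrite addrC map_f.
Qed.

End HomogeneousTensors.

(** * From tensors to coloured words and back *)

Section Separation.
Variables (K : fieldType) (V : lmodType K) (D : int -> V -> Prop).
Hypothesis gradV : is_grading D.
Variable pi : bool -> V -> V.
Hypothesis piP : parity_proj D pi.
Implicit Types (phi : seq (letter V) -> V) (F : seq V -> seq V -> V).

Fixpoint xpar (w : seq (letter V)) : bool :=
  if w is x :: w' then (~~ color x && par x) (+) xpar w' else false.

Lemma xpar_cat u v : xpar (u ++ v) = xpar u (+) xpar v.
Proof. by elim: u => //= x u ->; rewrite addbA. Qed.

(* The sign comes from moving the letters of colour [true] to the right. *)
Fixpoint sep F (w : seq (letter V)) : V :=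
  if w is x :: w' then
    if color x then
      (-1) ^+ (par x && xpar w') *: sep (fun a b => F a (pi (par x) x.2.2 :: b)) w'
    else sep (fun a b => F (pi (par x) x.2.2 :: a) b) w'
  else F [::] [::].

Lemma sep_ZD c F F' w :
  sep (fun a b => c *: F a b + F' a b) w = c *: sep F w + sep F' w.
Proof.
elim: w F F' => [|x w IH] F F' //=.
by case: ifP => _; rewrite IH // scalerDr !scalerA [_ * c]mulrC.
Qed.

Lemma sep_Z c F w : sep (fun a b => c *: F a b) w = c *: sep F w.
Proof.
elim: w F => [|x w IH] F //=.
by case: ifP => _; rewrite IH // !scalerA mulrC.
Qed.

Lemma pi_linear b : linear (pi b). Proof. by case: piP. Qed.

(** A parity component is a combination of homogeneous vectors of that parity, and the sign of
    graded commutativity depends only on the parities. *)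
Lemma word_sym_pi (U : lmodType K) (phi : seq V -> U) w a u b v w' :
  word_multilin phi -> word_sym D phi ->
  phi (w ++ [:: pi a u, pi b v & w']) =
  (-1) ^+ (a && b) *: phi (w ++ [:: pi b v, pi a u & w']).
Proof.
move=> M S; case: piP => _ _ H _.
have Mr x y c z z' : phi (w ++ [:: x, c *: z + z' & y])
    = c *: phi (w ++ [:: x, z & y]) + phi (w ++ [:: x, z' & y]).
  by have := M (rcons w x) c z z' y; rewrite !cat_rcons.
have M0 x y : phi (w ++ [:: x, 0 & y]) = 0.
  by have := Mr x y (-1) 0 0; rewrite scaler0 addr0 scaleN1r addNr.
have M0' y : phi (w ++ 0 :: y) = 0.
  by have := M w (-1) 0 0 y; rewrite scaler0 addr0 scaleN1r addNr.
have := H b v; elim=> [|c x y [j jb Dx] _ IH]; first by rewrite M0 M0' scaler0.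
rewrite Mr M IH scalerDr; congr (_ + _); rewrite !scalerA mulrC -scalerA.
congr (_ *: _); have := H a u; elim=> [|e z t [i ia Dz] _ IH']; first by rewrite M0 M0' scaler0.
rewrite Mr M IH' scalerDr; congr (_ + _); rewrite !scalerA mulrC -scalerA.
by rewrite (S i j) // signzE oddzM ia jb.
Qed.

Lemma biword_consl F x : biword D F -> biword D (fun a b => F (x :: a) b).
Proof.
case=> H1 H2 H3 H4; split.
- by move=> w' w; apply: (H1 w' (x :: w)).
- by move=> w' i j u v w; apply: (H2 w' _ _ _ _ (x :: w)).
- by move=> w; apply: H3.
by move=> w; apply: H4.
Qed.

Lemma biword_consr F x : biword D F -> biword D (fun a b => F a (x :: b)).
Proof.
case=> H1 H2 H3 H4; split.
- by move=> w'; apply: H1.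
- by move=> w'; apply: H2.
- by move=> w w1; apply: (H3 w (x :: w1)).
by move=> w i j u v w1; apply: (H4 w _ _ _ _ (x :: w1)).
Qed.

Lemma sep_multilin F : biword D F -> multilin (sep F).
Proof.
move=> B u; elim: u F B => [|x u IH] F B c b a v v' w /=.
  case: (B) => H1 _ H3 _; case: c => /=.
    rewrite pi_linear.
    have -> : (fun p q => F p (a *: pi b v + pi b v' :: q))
      = (fun p q => a *: F p (pi b v :: q) + F p (pi b v' :: q)).
      by apply/funext => p; apply/funext => q; apply: (H3 p [::]).
    by rewrite sep_ZD !parE scalerDr !scalerA [_ * a]mulrC.
  rewrite pi_linear.
  have -> : (fun p q => F (a *: pi b v + pi b v' :: p) q)
    = (fun p q => a *: F (pi b v :: p) q + F (pi b v' :: p) q).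
    by apply/funext => p; apply/funext => q; apply: (H1 q [::]).
  by rewrite sep_ZD.
have X v1 : xpar (u ++ lab c b v1 :: w) = xpar (u ++ lab c b 0 :: w).
  by rewrite !xpar_cat.
case: ifP => _; rewrite IH; do ?[exact: biword_consl | exact: biword_consr].
  by rewrite X (X v) (X v') scalerDr !scalerA [_ * a]mulrC.
by [].
Qed.

Lemma sep_proj_inv F : proj_inv pi (sep F).
Proof.
move=> u; elim: u F => [|x u IH] F c b v w /=.
  by rewrite !parE (projK piP) eqxx.
by rewrite !IH !xpar_cat.
Qed.

Lemma sep_supersym F : biword D F -> supersym (sep F).
Proof.
move=> B u; elim: u F B => [|z u IH] F B x y w /=.
  case: (B) => H1 H2 H3 H4; case cx: (color x); case cy: (color y) => /=.
  - have -> : (fun p q => F p [:: pi (par x) x.2.2, pi (par y) y.2.2 & q])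
      = (fun p q => (-1) ^+ (par x && par y) *:
           F p [:: pi (par y) y.2.2, pi (par x) x.2.2 & q]).
      by apply/funext => p; apply/funext => q; apply: (@word_sym_pi _ _ [::]).
    by rewrite sep_Z; lmod_signs K V.
  - by lmod_signs K V.
  - by lmod_signs K V.
  have -> : (fun p q => F [:: pi (par x) x.2.2, pi (par y) y.2.2 & p] q)
      = (fun p q => (-1) ^+ (par x && par y) *:
           F [:: pi (par y) y.2.2, pi (par x) x.2.2 & p] q).
    by apply/funext => p; apply/funext => q; apply: (@word_sym_pi _ (F^~ q) [::]).
  by rewrite sep_Z.
have X : xpar (u ++ [:: y, x & w]) = xpar (u ++ [:: x, y & w]).
  by rewrite !xpar_cat /=; congr (_ (+) _); rewrite addbCA.
case: ifP => _; last by rewrite (IH _ (biword_consl _ B) x y).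
rewrite (IH _ (biword_consr _ B) x y) X; lmod_signs K V.
Qed.

Lemma sep_colorless F w : (forall a, F a [::] = 0) ->
  ~~ has (@color K V) w -> sep F w = 0.
Proof.
elim: w F => [|x w IH] F F0 //=; rewrite negb_or => /andP[/negPf -> w0].
by apply: IH => // a; apply: F0.
Qed.

Lemma sep_hom k F : biword_deg D k F -> words_hom D k (sep F).
Proof.
move=> H d w Dw; elim: Dw k F H => {d w} [|i d c v w Dv Dw IH] k F H /=.
  by rewrite -[0]addr0; apply: H; apply: word_deg0.
case: (piP) => _ _ _ pE; rewrite !parE (pE _ _ _ Dv) eqxx.
rewrite (_ : i + d + k = d + (k + i)); last by ring.
case: ifP => _; [apply: (gradingZ gradV)|]; apply: IH => d' e a b Da Db.
  rewrite (_ : d' + e + (k + i) = d' + (i + e) + k); last by ring.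
  by apply: H => //; apply: word_degS.
rewrite (_ : d' + e + (k + i) = (i + d') + e + k); last by ring.
by apply: H => //; apply: word_degS.
Qed.

Lemma sep_sorted F u v :
  all (fun x : letter V => ~~ color x && (pi (par x) x.2.2 == x.2.2)) u ->
  all (fun x : letter V => color x && (pi (par x) x.2.2 == x.2.2)) v ->
  sep F (u ++ v) = F [seq x.2.2 | x <- u] [seq x.2.2 | x <- v].
Proof.
elim: u F => [|x u IH] F /=; last first.
  by case/andP=> /andP[/negPf -> /eqP ->] Hu Hv; rewrite IH.
move=> _; elim: v F => [|x v IH] F //= /andP[/andP[-> /eqP ->] Hv].
rewrite IH //; suff -> : xpar v = false by rewrite andbF scale1r.
by elim: v Hv {IH} => //= y v IH /andP[/andP[-> _] /IH ->].
Qed.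

End Separation.

Section Labelling.
Variables (K : fieldType) (V : lmodType K) (D : int -> V -> Prop).
Hypothesis gradV : is_grading D.
Variable pi : bool -> V -> V.
Hypothesis piP : parity_proj D pi.
Implicit Types (phi psi : seq (letter V) -> V).

(** Each vector is the sum of its two parity components, so an unlabelled word stands for the sum of
    all its labellings by parities. *)
Fixpoint label_sum c phi (w : seq V) : V :=
  if w is v :: w' then
    label_sum c (fun u => phi (lab c false v :: u)) w' + label_sum c (fun u => phi (lab c true v :: u)) w'
  else phi [::].

Lemma label_sum_ZD c a phi psi w :
  label_sum c (fun u => a *: phi u + psi u) w = a *: label_sum c phi w + label_sum c psi w.
Proof. elim: w phi psi => //= v w IH phi psi; rewrite !IH; lmod_signs K V. Qed.

Lemma label_sum_Z c a phi w : label_sum c (fun u => a *: phi u) w = a *: label_sum c phi w.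
Proof. by elim: w phi => //= v w IH phi; rewrite !IH scalerDr. Qed.

Lemma label_sum_0 c w : label_sum c (fun _ => 0) w = 0.
Proof. by elim: w => //= v w ->; rewrite addr0. Qed.

Lemma label_sum_congr c phi psi w :
  (forall u, all (fun x : letter V => color x == c) u -> phi u = psi u) ->
  label_sum c phi w = label_sum c psi w.
Proof.
elim: w phi psi => [|v w IH] phi psi H /=; first exact: H.
by congr (_ + _); apply: IH => u Hu; apply: H; rewrite /= eqxx.
Qed.

Lemma label_sum_cons_pi c phi b v w : multilin phi -> proj_inv pi phi ->
  label_sum c phi (pi b v :: w) = label_sum c (fun u => phi (lab c b v :: u)) w.
Proof.
move=> M P /=.
have E b' : (fun u => phi (lab c b' (pi b v) :: u))
    = if b' == b then (fun u => phi (lab c b v :: u)) else (fun _ => 0).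
  apply/funext => u; rewrite -(P [::]) /= (projK piP).
  case: eqP => [->|_]; first exact: (P [::]).
  exact: (multilin0 [::]).
by rewrite !E; case: b {E} => /=; rewrite label_sum_0 ?add0r ?addr0.
Qed.

Lemma label_sum_hom_cons c phi i v w : multilin phi -> proj_inv pi phi -> D i v ->
  label_sum c phi (v :: w) = label_sum c (fun u => phi (lab c (oddz i) v :: u)) w.
Proof.
move=> M P Dv; rewrite -label_sum_cons_pi //.
by case: piP => _ _ _ /(_ (oddz i) _ _ Dv); rewrite eqxx => ->.
Qed.

Lemma label_sum_multilin c phi : multilin phi -> word_multilin (label_sum c phi).
Proof.
move=> M w; elim: w phi M => [|x w IH] phi M a u v w' /=.
  have E b : (fun z => phi (lab c b (a *: u + v) :: z))
    = (fun z => a *: phi (lab c b u :: z) + phi (lab c b v :: z)).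
    by apply/funext => z; apply: (M [::]).
  rewrite !E !label_sum_ZD; lmod_signs K V.
by rewrite !IH ?scalerDr 1?addrACA //; apply: multilin_cons.
Qed.

Lemma label_sum_sym c phi : multilin phi -> proj_inv pi phi -> supersym phi ->
  word_sym D (label_sum c phi).
Proof.
move=> M P S i j u v w; elim: w phi M P S => [|x w IH] phi M P S w' Du Dv /=; last first.
  by rewrite !IH ?scalerDr //; do ?[exact: multilin_cons | exact: proj_inv_cons
    | exact: supersym_cons].
rewrite -[LHS]/(label_sum c phi [:: u, v & w']) -[in RHS]/(label_sum c phi [:: v, u & w']).
rewrite (label_sum_hom_cons _ _ M P Du) (label_sum_hom_cons _ _ M P Dv).
rewrite (label_sum_hom_cons _ _ (multilin_cons _ M) (proj_inv_cons _ P) Dv).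
rewrite (label_sum_hom_cons _ _ (multilin_cons _ M) (proj_inv_cons _ P) Du).
rewrite signzE oddzM -label_sum_Z; congr label_sum; apply/funext => z.
exact: (S [::]).
Qed.

Definition label_sum2 phi (w w' : seq V) : V :=
  label_sum false (fun u => label_sum true (fun u' => phi (u ++ u')) w') w.

Lemma label_sum2_ZD a phi psi w w' :
  label_sum2 (fun u => a *: phi u + psi u) w w' = a *: label_sum2 phi w w' + label_sum2 psi w w'.
Proof.
rewrite /label_sum2 -label_sum_ZD; congr label_sum; apply/funext => u; exact: label_sum_ZD.
Qed.

Section Slots.
Variable phi : seq (letter V) -> V.
Hypotheses (M : multilin phi) (P : proj_inv pi phi) (S : supersym phi).

Lemma multilin_cat u : multilin (fun w => phi (u ++ w)).
Proof. by move=> w c b a v v' w'; rewrite !catA M. Qed.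
Lemma proj_inv_cat u : proj_inv pi (fun w => phi (u ++ w)).
Proof. by move=> w c b v w'; rewrite !catA P. Qed.
Lemma supersym_cat u : supersym (fun w => phi (u ++ w)).
Proof. by move=> w x y w'; rewrite !catA (S _ x y). Qed.

Lemma multilin_label_sum_cat w' : multilin (fun w => label_sum true (fun u' => phi (w ++ u')) w').
Proof.
move=> u c b a v v' w; rewrite -label_sum_ZD; congr label_sum; apply/funext => z.
by rewrite -!catA /= M.
Qed.
Lemma proj_inv_label_sum_cat w' : proj_inv pi (fun w => label_sum true (fun u' => phi (w ++ u')) w').
Proof.
by move=> u c b v w; congr label_sum; apply/funext => z; rewrite -!catA /= P.
Qed.
Lemma supersym_label_sum_cat w' : supersym (fun w => label_sum true (fun u' => phi (w ++ u')) w').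
Proof.
move=> u x y w; rewrite -label_sum_Z; congr label_sum; apply/funext => z.
by rewrite -!catA /= (S _ x y).
Qed.

Lemma label_sum2_biword : biword D (label_sum2 phi).
Proof.
split.
- move=> w'; apply: label_sum_multilin; exact: multilin_label_sum_cat.
- move=> w'; apply: label_sum_sym; [exact: multilin_label_sum_cat|exact: proj_inv_label_sum_cat
    |exact: supersym_label_sum_cat].
- move=> w w1 a u v w2; rewrite /label_sum2 -label_sum_ZD; congr label_sum; apply/funext => z.
  exact/label_sum_multilin/multilin_cat.
move=> w i j u v w1 w2 Du Dv; rewrite /label_sum2 -label_sum_Z; congr label_sum; apply/funext => z.
by apply: label_sum_sym => //; [exact: multilin_cat|exact: proj_inv_cat|exact: supersym_cat].
Qed.

End Slots.

Lemma letters_deg_cat d e u v : letters_deg D d u -> letters_deg D e v ->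
  letters_deg D (d + e) (u ++ v).
Proof.
elim=> [|i d' c x w Dx _ IH] Dv; first by rewrite add0r.
by rewrite -addrA; apply: letters_degS => //; apply: IH.
Qed.

Lemma label_sum_hom_word c d w : word_deg D d w -> exists u,
  [/\ letters_deg D d u, all (fun x : letter V => color x == c) u
    & forall phi, multilin phi -> proj_inv pi phi -> label_sum c phi w = phi u].
Proof.
elim=> [|i e v w' Dv _ [u [Du cu H]]]; first by exists [::]; split=> //; apply: letters_deg0.
exists (lab c (oddz i) v :: u); split=> //=; first exact: letters_degS.
  by rewrite eqxx.
move=> phi M P; rewrite -[LHS]/(label_sum c phi (v :: w')) (label_sum_hom_cons _ _ M P Dv).
by rewrite H //; [exact: multilin_cons|exact: proj_inv_cons].
Qed.

Lemma label_sum2_deg k phi : multilin phi -> proj_inv pi phi -> words_hom D k phi ->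
  biword_deg D k (label_sum2 phi).
Proof.
move=> M P H d e w w' /(@label_sum_hom_word false)[u [Du _ wE]].
move=> /(@label_sum_hom_word true)[u' [Du' _ w'E]].
rewrite /label_sum2 wE; [|exact: multilin_label_sum_cat|exact: proj_inv_label_sum_cat].
rewrite w'E; [|exact: multilin_cat|exact: proj_inv_cat].
exact/H/letters_deg_cat.
Qed.

Lemma label_sum2_nil phi w :
  (forall u, ~~ has (@color K V) u -> phi u = 0) -> label_sum2 phi w [::] = 0.
Proof.
move=> H; rewrite -[RHS](label_sum_0 false w); apply: label_sum_congr => u cu /=.
rewrite cats0 H // -all_predC; apply: sub_all cu => x /=.
by case: color.
Qed.

Lemma wpar_xpar u v : all (fun x : letter V => color x == false) u ->
  all (fun x : letter V => color x == true) v -> xpar (u ++ v) = wpar u.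
Proof.
elim: u => [|x u IH] /=; last by case/andP=> /eqP -> Hu Hv; rewrite IH.
by move=> _; elim: v => //= x v IH /andP[/eqP ->].
Qed.

(** Nothing is lost in passing from coloured words to tensors and back, which is what allows a
    product to be fed into another product. *)
Lemma sep_label_sum2 phi : multilin phi -> proj_inv pi phi -> supersym phi ->
  sep pi (label_sum2 phi) = phi.
Proof.
move=> M P S; apply/funext => w; elim: w phi M P S => [|[c [b v]] w IH] phi M P S //=.
rewrite -/(lab c b v) !parE; case: c => /=; last first.
  rewrite -[RHS](IH _ (multilin_cons _ M) (proj_inv_cons _ P) (supersym_cons _ S)).
  congr sep; apply/funext => p; apply/funext => q.
  by rewrite /label_sum2 (label_sum_cons_pi _ _ _ _ (multilin_label_sum_cat M q)
    (proj_inv_label_sum_cat P q)).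
(* [label_sum2] places the leading letter behind those of colour [false]. Bringing it back to the
   front by supersymmetry costs this sign, which cancels the one in [sep]. *)
pose psi u := (-1) ^+ (b && xpar u) *: phi (lab true b v :: u).
have -> : (fun p q => label_sum2 phi p (pi b v :: q)) = label_sum2 psi.
  apply/funext => p; apply/funext => q; apply: label_sum_congr => u cu.
  rewrite (label_sum_cons_pi _ _ _ _ (multilin_cat M u) (proj_inv_cat P u)).
  apply: label_sum_congr => u' cu'; rewrite /psi (supersym_front _ _ _ S) parE.
  by rewrite wpar_xpar.
rewrite IH.
- by rewrite /psi scalerA -signr_addb addbb scale1r.
- move=> u c b' a x x' w'; rewrite /psi !xpar_cat /= (multilin_cons _ M).
  lmod_signs K V.
- by move=> u c b' x w'; rewrite /psi !xpar_cat /= (proj_inv_cons _ P).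
move=> u x y w'; rewrite /psi !xpar_cat /= [xpar u (+) _](_ : _ =
  xpar u (+) (~~ color y && par y (+) (~~ color x && par x (+) xpar w'))).
  by rewrite (supersym_cons _ S u x y) !scalerA mulrC.
by congr (_ (+) _); rewrite addbCA.
Qed.

End Labelling.

(** * Shuffles and colourings *)

Section ShuffleColorings.
Variable n : nat.
Implicit Types (s : 'S_n) (c : n.-tuple 'I_3).

Definition block_index (p q i : nat) : nat :=
  if (i < p)%N then 0 else if (i < p + q)%N then 1 else 2.

Lemma reshape_index3 p q i : (p + q <= n)%N -> (i < n)%N ->
  reshape_index [:: p; q; n - p - q]%N i = block_index p q i.
Proof.
move=> pq i_n; rewrite /reshape_index /block_index /=.
have -> : (i.+1 - p == 0)%N = (i < p)%N by rewrite subn_eq0.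
case: (ltnP i p) => // pi.
have -> : (i.+1 - p - q == 0)%N = (i < p + q)%N by rewrite -subnDA subn_eq0.
case: (ltnP i _) => // pqi.
by rewrite -!subnDA addnA subnKC // subn_eq0 i_n.
Qed.

Lemma map_block_index p q : (p + q <= n)%N ->
  map (block_index p q) (iota 0 n) = nseq p 0 ++ nseq q 1 ++ nseq (n - p - q) 2.
Proof.
move=> pq.
have E : (p + q + (n - p - q) = n)%N by rewrite -subnDA subnKC.
rewrite -[n in iota _ n]E -addnA !iotaD !map_cat add0n.
have cst (m k v : nat) : (forall i, (m <= i < m + k)%N -> block_index p q i = v) ->
    map (block_index p q) (iota m k) = nseq k v.
  move=> H; rewrite -[in RHS](size_iota m k) -(size_map (block_index p q)).
  by apply/all_pred1P; rewrite all_map; apply/allP => i; rewrite mem_iota => /H /= ->.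
congr (_ ++ _ ++ _); apply: cst => i; rewrite /block_index.
- by rewrite add0n => /andP[_ ->].
- by case/andP=> pi ->; rewrite ltnNge pi.
case/andP=> pqi _; rewrite ltnNge (leq_trans _ pqi) ?leq_addr //= ltnNge.
by rewrite pqi.
Qed.

Definition shuffle_coloring (p q : nat) s : n.-tuple 'I_3 :=
  [tuple inord (block_index p q (s^-1%g a)) | a < n].

Definition color_class c (j : nat) : seq 'I_n := [seq a <- enum 'I_n | tnth c a == j :> nat].

Lemma shuffle_coloringE p q s i : tnth (shuffle_coloring p q s) (s i) = block_index p q i :> nat.
Proof. by rewrite tnth_mktuple permK inordK // /block_index; do 2?case: ifP. Qed.

Lemma pairwise_enum : pairwise (fun a b : 'I_n => a < b)%N (enum 'I_n).
Proof.
rewrite -(pairwise_map val ltn) val_enum_ord -sorted_pairwise ?iota_ltn_sorted //.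
exact: ltn_trans.
Qed.

(** Colour first, then position: the word of a shuffle is sorted for this relation. *)
Definition lexr c : rel 'I_n := fun a b =>
  (tnth c a < tnth c b)%N || (tnth c a == tnth c b) && (a < b)%N.

Lemma lexr_antisym c : antisymmetric (lexr c).
Proof.
move=> a b; rewrite /lexr -!val_eqE /=.
by case: (ltngtP (tnth c a) (tnth c b)) => //= _; case: ltngtP.
Qed.

(* The word s(1) ... s(n) of a shuffle [s] with colouring [c], see [shuffle_map]. *)
Definition color_sort c := color_class c 0 ++ color_class c 1 ++ color_class c 2.

Lemma mem_color_class c j a : (a \in color_class c j) = (tnth c a == j :> nat).
Proof. by rewrite mem_filter mem_enum andbT. Qed.

Lemma color_class_lexr c j : pairwise (lexr c) (color_class c j).
Proof.
have := pairwise_filter (fun a => tnth c a == j :> nat) pairwise_enum.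
apply: sub_in_pairwise (filter_all _ _) => a b /eqP ca /eqP cb ab.
by rewrite /lexr -val_eqE /= ca cb eqxx ab orbT.
Qed.

Lemma color_sort_lexr c : pairwise (lexr c) (color_sort c).
Proof.
have lt j k : (j < k)%N -> allrel (lexr c) (color_class c j) (color_class c k).
  move=> jk; apply/allrelP => a b; rewrite !mem_color_class /lexr => /eqP -> /eqP ->.
  by rewrite jk.
by rewrite !pairwise_cat allrel_catr !lt // !color_class_lexr.
Qed.

Lemma perm_color_sort c : perm_eq (color_sort c) (enum 'I_n).
Proof.
apply: uniq_perm; rewrite ?enum_uniq //.
  by apply: pairwise_uniq (color_sort_lexr c) => a; rewrite /lexr !ltnn andbF.
move=> a; rewrite !mem_cat !mem_color_class mem_enum.
by case: (tnth c a) => [[|[|[|k]]]].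
Qed.

Lemma perm_map_enum s : perm_eq (map s (enum 'I_n)) (enum 'I_n).
Proof.
apply: uniq_perm => [||a]; rewrite ?(map_inj_uniq (@perm_inj _ s)) ?enum_uniq //.
by rewrite mem_enum -(permKV s a) map_f ?mem_enum.
Qed.

Lemma map_color_shuffle p q s : (p + q <= n)%N ->
  [seq val (tnth (shuffle_coloring p q s) a) | a <- map s (enum 'I_n)]
  = nseq p 0 ++ nseq q 1 ++ nseq (n - p - q) 2.
Proof.
move=> pq; rewrite -map_block_index // -val_enum_ord -!map_comp; apply: eq_map => i /=.
exact: shuffle_coloringE.
Qed.

Lemma size_color_class c j s :
  size (color_class c j) = count_mem j [seq val (tnth c a) | a <- map s (enum 'I_n)].
Proof.
by rewrite count_map (seq.permP (perm_map_enum s)) size_filter.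
Qed.

Lemma block_index_mono p q i j : (i <= j)%N -> (block_index p q i <= block_index p q j)%N.
Proof.
move=> ij; rewrite /block_index; case: (ltnP i p) => // pi.
rewrite [(j < p)%N]ltnNge (leq_trans pi ij) /=; case: (ltnP i) => // [_|pqi]; first by case: ifP.
by rewrite ltnNge (leq_trans pqi ij).
Qed.

(** Both words are permutations of the same list, sorted for the antisymmetric relation [lexr c], so
    they agree. Hence the colouring determines both the block lengths and the shuffle. *)
Lemma shuffle_map p q s : (p + q <= n)%N -> shuffle [:: p; q; n - p - q]%N s ->
  let c := shuffle_coloring p q s in
  [/\ map s (enum 'I_n) = color_sort c,
      size (color_class c 0) = p & size (color_class c 1) = q].
Proof.
move=> pq sh c; split.
- apply: (pairwise_eq (@lexr_antisym c)); last 1 first.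
  + by rewrite (perm_trans (perm_map_enum s)) // perm_sym perm_color_sort.
  + rewrite pairwise_map; apply: sub_pairwise pairwise_enum => i j /= ij.
    move/forallP/(_ i)/forallP/(_ j): sh; rewrite ij !reshape_index3 //= /lexr -val_eqE /=.
    rewrite !shuffle_coloringE; have := block_index_mono p q (ltnW ij).
    by case: (ltngtP (block_index p q i)).
  + exact: color_sort_lexr.
- by rewrite (size_color_class _ _ s) map_color_shuffle // !count_cat !count_nseq /= addn0 mul1n.
by rewrite (size_color_class _ _ s) map_color_shuffle // !count_cat !count_nseq /= addn0 mul1n.
Qed.

(** Conversely, reading [color_sort c] position by position gives a shuffle with colouring [c]. *)
Lemma shuffle_of_coloring c :
  let p := size (color_class c 0) in let q := size (color_class c 1) in
  exists s, [/\ (p + q <= n)%N, shuffle [:: p; q; n - p - q]%N s & shuffle_coloring p q s = c].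
Proof.
move=> p q.
have sz : size (color_sort c) = n by rewrite (perm_size (perm_color_sort c)) size_enum_ord.
have sum : (p + q + size (color_class c 2))%N = n by rewrite -addnA -!size_cat sz.
have pq : (p + q <= n)%N by have := leq_addr (size (color_class c 2)) (p + q); rewrite sum.
have r_ : size (color_class c 2) = (n - p - q)%N 
  by have := addKn (p + q) (size (color_class c 2)); rewrite sum subnDA.
(* The index itself serves as default value, so that n = 0 needs no element of ['I_n]. *)
have inj : injective (fun i : 'I_n => nth i (color_sort c) i).
  move=> i j /eqP; rewrite (set_nth_default i) ?sz ?ltn_ord // nth_uniq ?sz ?ltn_ord //.
    by move/eqP/val_inj.
  by rewrite (perm_uniq (perm_color_sort c)) enum_uniq.
pose s := perm inj.
have ms : map s (enum 'I_n) = color_sort c.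
  case E: (color_sort c) (sz) => [|i0 r] n0.
    by apply/eqP; rewrite -size_eq0 size_map size_enum_ord -n0.
  rewrite -E; apply: (@eq_from_nth _ i0); rewrite size_map size_enum_ord ?sz //.
  move=> i i_n; rewrite (nth_map i0) ?size_enum_ord // permE.
  by rewrite nth_enum_ord //; apply: set_nth_default; rewrite sz.
exists s.
have cst j : [seq val (tnth c a) | a <- color_class c j] = nseq (size (color_class c j)) j.
  rewrite -(size_map (fun a => val (tnth c a))); apply/all_pred1P; rewrite all_map.
  by apply/allP => a; rewrite mem_color_class.
have cs i : tnth c (s i) = block_index p q i :> nat.
  have /eq_in_map H : [seq val (tnth c (s i)) | i <- enum 'I_n]
      = [seq block_index p q (val i) | i <- enum 'I_n].
    rewrite (map_comp (fun a => val (tnth c a)) s) (map_comp (block_index p q) val) val_enum_ord.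
    by rewrite ms !map_cat !cst r_ map_block_index.
  by apply: H; rewrite mem_enum.
split=> //.
  apply/forallP => i; apply/forallP => j; apply/implyP => /andP[ij].
  rewrite !reshape_index3 // -!cs.
  have := color_sort_lexr c; rewrite -ms pairwise_map => /(pairwiseP i)/(_ i j).
  rewrite !inE size_enum_ord !ltn_ord !nth_ord_enum ij => /(_ isT isT isT).
  by rewrite /= /lexr -val_eqE /=; case: (ltngtP (tnth c (s i))).
apply: eq_from_tnth => a; apply: val_inj; rewrite -(permKV s a).
by rewrite /= shuffle_coloringE cs.
Qed.

End ShuffleColorings.

(** * Splittings of a word and their Koszul signs *)

Section Splitting.
Variables (K : fieldType) (U : lmodType K) (T : Type) (p : T -> bool).
Implicit Types (Phi : seq T -> seq T -> seq T -> U).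

Fixpoint tpar (w : seq T) : bool := if w is x :: w' then p x (+) tpar w' else false.

(** A letter sent to one of the later words passes all the letters still to be read that go to
    earlier words; this is the source of the signs. *)
Fixpoint split3 Phi (w : seq T) : U :=
  if w is x :: w' then
    split3 (fun a b c => Phi (x :: a) b c) w'
    + split3 (fun a b c => (-1) ^+ (p x && tpar a) *: Phi a (x :: b) c) w'
    + split3 (fun a b c => (-1) ^+ (p x && (tpar a (+) tpar b)) *: Phi a b (x :: c)) w'
  else Phi [::] [::] [::].

Definition below k (c : seq 'I_3) (w : seq T) := mask [seq (val i < k)%N | i <- c] w.
Definition class k (c : seq 'I_3) (w : seq T) := mask [seq val i == k | i <- c] w.

Fixpoint color_sign (c : seq 'I_3) (w : seq T) : K :=
  match c, w with
  | k :: c', x :: w' => (-1) ^+ (p x && tpar (below k c' w')) * color_sign c' w'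
  | _, _ => 1
  end.

Lemma below0 c w : below 0 c w = [::].
Proof. by elim: c w => [|k c IH] [|x w] //; apply: IH. Qed.

Lemma tpar_below1 c w : tpar (below 1 c w) = tpar (class 0 c w).
Proof. by rewrite /below /class; congr (tpar (mask _ _)); apply: eq_map => -[[]]. Qed.

Lemma tpar_below2 c w : tpar (below 2 c w) = tpar (class 0 c w) (+) tpar (class 1 c w).
Proof.
elim: c w => [|k c IH] [|x w] //; rewrite /below /class /=.
case: k => [[|[|[|k]]]] //= _; move: (IH w); rewrite /below /class => -> //.
  by rewrite addbA.
by rewrite addbCA.
Qed.

Lemma big_tuple_cons (n : nat) (I : finType) (F : n.+1.-tuple I -> U) :
  \sum_c F c = \sum_k \sum_(c : n.-tuple I) F [tuple of k :: c].
Proof.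
rewrite pair_big /= (reindex (fun u : I * n.-tuple I => [tuple of u.1 :: u.2])) //=.
exists (fun c => (thead c, [tuple of behead c])) => [[k c] _|c _] /=.
  by rewrite theadE; congr pair; apply: val_inj.
by case/tupleP: c => k c; apply: val_inj; rewrite /= theadE.
Qed.

Lemma split3_colorings n Phi w : size w = n ->
  split3 Phi w = \sum_(c : n.-tuple 'I_3)
    color_sign c w *: Phi (class 0 c w) (class 1 c w) (class 2 c w).
Proof.
elim: w n Phi => [|x w IH] [|n] Phi //= => [_|[sw]].
  rewrite (big_pred1 [tuple]) => [|c]; last by rewrite /= [c]tuple0; apply/esym/eqP.
  by rewrite /= scale1r.
rewrite big_tuple_cons !big_ord_recl big_ord0 addr0 addrA !(IH n) //.
congr (_ + _ + _); apply: eq_bigr => c _; rewrite /= ?scalerA.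
- by rewrite below0 andbF mul1r.
- by rewrite tpar_below1 mulrC.
by rewrite tpar_below2 mulrC.
Qed.

End Splitting.

Section ShuffleSums.
Variables (K : fieldType) (n : nat) (d : 'I_n -> int).
Implicit Types (s : 'S_n).

Let p (i : 'I_n) := oddz (d i).

Lemma prod_tpar (U : Type) (q : U -> bool) b (P : pred U) (r : seq U) :
  \prod_(j <- r | P j) (-1 : K) ^+ (b && q j) = (-1) ^+ (b && tpar q (filter P r)).
Proof.
elim: r => [|j r IH]; first by rewrite big_nil andbF.
rewrite big_cons /= IH; case: ifP => //= _; rewrite -signr_addb.
by case: b {IH}.
Qed.

Lemma color_sign_prod (c : 'I_n -> 'I_3) (r : seq 'I_n) :
  pairwise (fun a b : 'I_n => a < b)%N r ->
  color_sign K p (map c r) r =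
  \prod_(a <- r) \prod_(b <- r | (a < b)%N && (c b < c a)%N) (-1) ^+ (p a && p b).
Proof.
elim: r => [|a r IH] /=; first by rewrite big_nil.
case/andP=> /allP ar pr; rewrite big_cons big_cons ltnn /= IH //; congr (_ * _).
  rewrite prod_tpar /below; congr (_ ^+ (_ && tpar _ _)).
  rewrite -map_comp -filter_mask; apply: eq_in_filter => b /ar /= ab.
  by rewrite ab.
by apply: eq_big_seq => b /ar ab; rewrite big_cons ltnNge (ltnW ab).
Qed.

(** A shuffle has inversions only between different blocks. An inversion i < j, s j < s i is thus
    the same as a pair a = s j < b = s i with inverted colours. *)
Lemma koszul_shuffle q r s : (q + r <= n)%N -> shuffle [:: q; r; n - q - r]%N s ->
  koszul K d s = color_sign K p (shuffle_coloring q r s) (enum 'I_n).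
Proof.
move=> qr sh; pose c := shuffle_coloring q r s.
have -> : tval (shuffle_coloring q r s) = map (tnth c) (enum 'I_n).
  by rewrite map_tnth_enum.
rewrite color_sign_prod ?pairwise_enum // big_enum /=.
under [RHS]eq_bigr => a _ do rewrite big_enum_cond /=.
(* The smaller letter of an inverted pair has the larger preimage under [s], so the two products are
   exchanged before reindexing. *)
rewrite [RHS](exchange_big_dep xpredT) //= /koszul.
rewrite [RHS](reindex_inj (@perm_inj _ s)) /=; apply: eq_bigr => i _.
rewrite [RHS](reindex_inj (@perm_inj _ s)) /=; apply: eq_big => j.
  rewrite !shuffle_coloringE andbC; case: ltnP => //= sji.
  case: (ltngtP i j) => [ij|ji|/val_inj ij].
  - rewrite ltn_neqAle block_index_mono ?(ltnW ij) // andbT; apply/esym/negP => E.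
    move/forallP/(_ i)/forallP/(_ j): sh; rewrite ij !reshape_index3 // E /=.
    by rewrite ltnNge ltnW.
  - by apply/esym/negbTE; rewrite -leqNgt block_index_mono // ltnW.
  by rewrite ij ltnn.
by move=> _; rewrite signzE oddzM andbC.
Qed.

Variables (U : lmodType K) (Phi : seq 'I_n -> seq 'I_n -> seq 'I_n -> U).

Lemma split3_shuffles :
  split3 p Phi (enum 'I_n) =
  \sum_(0 <= q < n.+1) \sum_(0 <= r < n.+1 | (q + r <= n)%N)
    \sum_(s : 'S_n | shuffle [:: q; r; n - q - r]%N s)
      (let w := map s (enum 'I_n) in
       koszul K d s *: Phi (take q w) (take r (drop q w)) (drop (q + r) w)).
Proof.
rewrite (split3_colorings _ _ (size_enum_ord n)).
under [RHS]eq_bigr => q _ do rewrite big_mkord.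
rewrite big_mkord pair_big_dep pair_big_dep /=.
(* The triples (q, r, s) are grouped by colouring; each fibre then consists of one triple. *)
rewrite [RHS](partition_big (fun t : 'I_n.+1 * 'I_n.+1 * 'S_n =>
  shuffle_coloring t.1.1 t.1.2 t.2) xpredT) //=.
apply: eq_bigr => c _.
have [s0 [qr0 sh0 c0]] := shuffle_of_coloring c.
set q0 := size _ in qr0 sh0 c0; set r0 := size _ in qr0 sh0 c0.
have q0n : (q0 < n.+1)%N by rewrite ltnS (leq_trans _ qr0) ?leq_addr.
have r0n : (r0 < n.+1)%N by rewrite ltnS (leq_trans _ qr0) ?leq_addl.
rewrite (big_pred1 (Ordinal q0n, Ordinal r0n, s0)) /=; last first.
  case=> [[q r] s] /=; apply/andP/eqP => [[/andP[qr sh] /eqP cE]|[-> -> ->]]; last first.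
    by rewrite /= qr0 sh0 c0 eqxx.
  have [ms qE rE] := shuffle_map qr sh; have [ms0 _ _] := shuffle_map qr0 sh0.
  rewrite cE in ms qE rE; rewrite c0 in ms0.
  congr (_, _, _); try exact: val_inj.
  apply/permP => i; move: ms; rewrite -ms0 => /eq_in_map; apply.
  by rewrite mem_enum.
have [ms qE rE] := shuffle_map qr0 sh0; rewrite c0 in ms qE rE.
rewrite (koszul_shuffle qr0 sh0) c0 ms /color_sort.
have cE j : class j c (enum 'I_n) = color_class c j.
  rewrite /color_class filter_mask /class -[in LHS](map_tnth_enum c) -map_comp.
  by congr mask; apply: eq_map.
rewrite !cE [(q0 + r0)%N]addnC -drop_drop take_size_cat // !drop_size_cat //.
by rewrite take_size_cat.
Qed.

End ShuffleSums.

Section TwoBlocks.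
Variables (K : fieldType) (U : lmodType K).

Section Split2.
Variables (T : Type) (p : T -> bool).
Implicit Types (Phi : seq T -> seq T -> U).

Fixpoint split2 Phi (w : seq T) : U :=
  if w is x :: w' then
    split2 (fun a b => Phi (x :: a) b) w'
    + split2 (fun a b => (-1) ^+ (p x && tpar p a) *: Phi a (x :: b)) w'
  else Phi [::] [::].

Lemma split3_0 w : split3 p (fun _ _ _ => 0 : U) w = 0.
Proof.
elim: w => //= x w IH; rewrite IH.
have E (e : seq T -> seq T -> seq T -> bool) :
    (fun a b c => (-1) ^+ e a b c *: (0 : U)) = (fun _ _ _ => 0).
  by apply/funext => a; apply/funext => b; apply/funext => c; rewrite scaler0.
by rewrite (E (fun a b c => _)) (E (fun a b c => _)) IH !addr0.
Qed.

Lemma split2_split3 Phi w :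
  split2 Phi w = split3 p (fun a b c => if c is [::] then Phi a b else 0) w.
Proof.
elim: w Phi => //= x w IH Phi; rewrite !IH.
have -> : (fun a b c : seq T => (-1) ^+ (p x && (tpar p a (+) tpar p b)) *: (0 : U))
    = (fun _ _ _ => 0).
  by apply/funext => a; apply/funext => b; apply/funext => c; rewrite scaler0.
rewrite split3_0 addr0; congr (_ + split3 _ _ _).
apply/funext => a; apply/funext => b; apply/funext => -[] //=.
by move=> *; rewrite scaler0.
Qed.

End Split2.

Variables (n : nat) (d : 'I_n -> int) (Phi : seq 'I_n -> seq 'I_n -> U).

Lemma shuffle2 q (s : 'S_n) : (q <= n)%N ->
  shuffle [:: q; n - q; n - q - (n - q)]%N s = shuffle [:: q; n - q]%N s :> bool.
Proof.
move=> qn; apply: eq_forallb => i; apply: eq_forallb => j.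
have E k : (k < n)%N -> reshape_index [:: q; n - q; n - q - (n - q)]%N k
   = reshape_index [:: q; n - q]%N k.
  move=> kn; rewrite /reshape_index /=; case: ifP => // _; case: ifP => //.
  by rewrite -subnDA subnKC // subn_eq0 kn.
by rewrite !E.
Qed.

Lemma split2_shuffles :
  split2 (fun i => oddz (d i)) Phi (enum 'I_n) =
  \sum_(0 <= q < n.+1) \sum_(s : 'S_n | shuffle [:: q; n - q]%N s)
    (let w := map s (enum 'I_n) in koszul K d s *: Phi (take q w) (drop q w)).
Proof.
rewrite split2_split3 split3_shuffles; apply: eq_big_nat => q /andP[_ qn].
have {}qn : (q <= n)%N by [].
rewrite big_mkord.
have nqn : (n - q < n.+1)%N by rewrite ltnS leq_subr.
rewrite (bigD1 (Ordinal nqn)) /=; last by rewrite subnKC.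
rewrite [X in _ + X]big1 ?addr0 => [|r /andP[qr rn]]; last first.
  rewrite big1 // => s _.
  case E: (drop _ _) => [|x w']; last by rewrite scaler0.
  move/(congr1 size): E; rewrite size_drop size_map size_enum_ord => /eqP.
  rewrite subn_eq0 => nqr; case/eqP: rn; apply: val_inj => /=.
  by apply/eqP; rewrite -(eqn_add2l q) subnKC // eqn_leq qr.
apply: eq_big => [s|s _]; first exact: shuffle2.
have sz : size (map s (enum 'I_n)) = n by rewrite size_map size_enum_ord.
rewrite subnKC // drop_oversize ?sz // [take (n - q) _]take_oversize //.
by rewrite size_drop sz.
Qed.

(** The second sum of the required formula is indexed by the length of the second block, the letters
    that enter [g]. *)
Lemma split2_shuffles_rev :
  split2 (fun i => oddz (d i)) Phi (enum 'I_n) =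
  \sum_(0 <= r < n.+1) \sum_(s : 'S_n | shuffle [:: n - r; r]%N s)
    (let w := map s (enum 'I_n) in
     koszul K d s *: Phi (take (n - r) w) (drop (n - r) w)).
Proof.
rewrite split2_shuffles big_nat_rev /=; apply: eq_big_nat => r /andP[_ rn].
by rewrite add0n subSS subKn.
Qed.

End TwoBlocks.

Section InsertionSplitting.
Variables (K : fieldType) (V : lmodType K).
Implicit Types (f g h : seq (letter V) -> V).

Lemma multilin_scale f u c b a v w : multilin f ->
  f (u ++ lab c b (a *: v) :: w) = a *: f (u ++ lab c b v :: w).
Proof. by move=> M; rewrite -[a *: v]addr0 M multilin0 // addr0. Qed.

(** Every letter is passed by [h], and moving the value from the end to the front costs the same
    sign again, so the signs cancel. *)
Lemma ins_colored c k h f (w : seq (letter V)) : multilin f -> supersym f ->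
  all (@color K V) w -> (forall y u, color y -> h (y :: u) = 0) ->
  ins c k h f w = f (lab c k (h [::]) :: w).
Proof.
move=> M S + h0; elim: w f k M S => //= y w IH f k M S /andP[cy cw].
have -> : (fun u => h (y :: u)) = (fun _ => 0) by apply/funext => u; apply: h0.
rewrite ins_0l // addr0 IH //; [|exact: multilin_cons|exact: supersym_cons].
by rewrite (S [::]) scalerA parE andbC -signr_addb addbb scale1r.
Qed.

Lemma split3_Z (U : lmodType K) (T : Type) (p : T -> bool) a
    (Phi : seq T -> seq T -> seq T -> U) w :
  split3 p (fun x y z => a *: Phi x y z) w = a *: split3 p Phi w.
Proof.
elim: w Phi => //= x w IH Phi; rewrite !scalerDr -!IH.
congr (_ + _ + _); congr (split3 _ _ _); apply/funext => u; apply/funext => v;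
  by apply/funext => z; rewrite /= !scalerA 1?mulrC.
Qed.

Lemma split2_Z (U : lmodType K) (T : Type) (p : T -> bool) a
    (Phi : seq T -> seq T -> U) w :
  split2 p (fun x y => a *: Phi x y) w = a *: split2 p Phi w.
Proof.
elim: w Phi => //= x w IH Phi; rewrite scalerDr -!IH.
congr (_ + _); congr (split2 _ _ _); apply/funext => u; apply/funext => v;
  by rewrite /= !scalerA 1?mulrC.
Qed.

Section Words.
Variables (T : Type) (x : T -> V) (p : T -> bool).
Let L c (t : T) := lab c (p t) (x t).

Lemma wpar_map_lab c w : wpar (map (L c) w) = tpar p w.
Proof. by elim: w => //= t w ->. Qed.

(** A letter of [w] enters [g] with colour [false], enters [g] recoloured to [true], or is kept for
    [f]: these are the three blocks. Moving the value of [g] to the front cancels the dependence of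
    the sign on [k], leaving the sign of the splitting. *)
Lemma ins_recolor_split3 k g f w (z : seq (letter V)) :
  multilin f -> supersym f -> supersym g -> all (@color K V) z ->
  ins false k (recolor g) f (map (L false) w ++ z)
  = split3 p (fun a b c =>
      f (lab false (k (+) tpar p a (+) tpar p b) (g (map (L false) a ++ map (L true) b))
         :: map (L false) c ++ z)) w.
Proof.
move=> + + + cz; elim: w k g f => [|t w IH] k g f M S Sg /=.
  rewrite ins_colored // ?addbF // => y u cy.
  exact: (recolor_colored _ [::]).
rewrite ins_Dl // addrC; congr (_ + _).
- rewrite !parE (IH (k (+) p t)) //; last exact: supersym_cons.
  rewrite (IH (k (+) p t)) //; last exact: supersym_cons.
  congr (_ + _); congr (split3 _ _ _);
    apply/funext => a; apply/funext => b; apply/funext => c.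
    by rewrite !addbA.
  rewrite -/(L true t) (supersym_front _ _ _ Sg) wpar_map_lab parE.
  rewrite (multilin_scale [::]) // scalerA -signr_addb addbb scale1r.
  by rewrite -!addbA [p t (+) _]addbCA.
rewrite parE IH //; [|exact: multilin_cons|exact: supersym_cons].
rewrite -split3_Z; congr split3.
apply/funext => a; apply/funext => b; apply/funext => c.
rewrite (S [::]) scalerA !parE -signr_addb; congr (_ *: _).
by case: (p t); case: k; case: (tpar p a); case: (tpar p b).
Qed.

End Words.

(** The kept letters of colour [false] remain in front of the value of [g], so the sign for [g]
    passing them survives; it is the factor with exponent l(x_1 + ...) of the second sum. *)
Lemma ins_split2 (T T' : Type) (x : T -> V) (p : T -> bool) (y : T' -> V) (q : T' -> bool)
    k g f w z : multilin f -> supersym f ->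
  let L t := lab false (p t) (x t) in let R t := lab true (q t) (y t) in
  ins true k g f (map L w ++ map R z)
  = split2 p (fun a b => split2 q (fun c e =>
      (-1) ^+ (k && tpar p a) *:
      f (map L a ++ lab true (k (+) tpar p b (+) tpar q c) (g (map L b ++ map R c))
         :: map R e)) z) w.
Proof.
move=> M S L R; elim: w k g f M S => [|t w IH] k g f M S /=.
  elim: z k g f M S => [|t z IH] k g f M S /=.
    by rewrite andbF scale1r !addbF.
  rewrite addrC !parE !IH //; [|exact: multilin_cons|exact: supersym_cons].
  congr (_ + _).
    congr split2; apply/funext => c; apply/funext => e.
    by rewrite !andbF !addbF addbA.
  rewrite -split2_Z; congr split2; apply/funext => c; apply/funext => e.
  rewrite (S [::]) !scalerA !parE !andbF !addbF mulr1 mul1r -signr_addb /=.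
  congr (_ *: _).
  by case: (q t); case: k; case: (tpar q c).
rewrite !parE !IH //; [|exact: multilin_cons|exact: supersym_cons].
congr (_ + _); rewrite -?split2_Z; congr split2; apply/funext => a; apply/funext => b;
  rewrite -split2_Z; congr split2; apply/funext => c; apply/funext => e.
  by rewrite scalerA -signr_addb andb_addr.
rewrite scalerA -signr_addb addbA; congr (_ *: _).
by case: (p t); case: k; case: (tpar p a).
Qed.

End InsertionSplitting.

(** * The graded pre-Lie product *)

Section GradedBilinear.
Variables (K : fieldType) (A : lmodType K) (D : int -> A -> Prop).
Hypothesis gradA : is_grading D.

Lemma bilinear_ext (b b' : A -> A -> A) : bilinear_op b -> bilinear_op b' ->
  (forall k l x y, D k x -> D l y -> b x y = b' x y) -> b = b'.
Proof.
move=> [br bl] [br' bl'] H; apply/funext => x; apply/funext => y.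
case: gradA => _ span _.
elim: (span x) => [|a u v [k Du] _ IHx].
  by rewrite (linear_fun0 (bl y)) (linear_fun0 (bl' y)).
rewrite (bl y) (bl' y) IHx; congr (_ *: _ + _).
elim: (span y) => [|c s t [l Ds] _ IHy].
  by rewrite (linear_fun0 (br u)) (linear_fun0 (br' u)).
by rewrite (br u) (br' u) IHy (H k l).
Qed.

Lemma supercommutator_exists (c : A -> A -> A) : bilinear_op c ->
  exists b : A -> A -> A, bilinear_op b /\
    forall k l x y, D k x -> D l y -> b x y = c x y - (-1) ^ (k * l) *: c y x.
Proof.
move=> [cr cl]; have [P [Plin _ _ Phom]] := parity_proj_exists gradA.
(* The sign depends on degrees, but the bracket must be bilinear on all maps; the signed flip is
   therefore written with the parity projections of both arguments, negative only when both are
   odd. *)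
pose sw x y := (c (P false y) (P false x) + c (P true y) (P false x))
  + (c (P false y) (P true x) - c (P true y) (P true x)).
exists (fun x y => c x y - sw x y); split.
  split=> [x a u v|y a u v]; rewrite /sw.
    rewrite !Plin !(cl (P _ x)) (cr x); lmod_signs K A.
  rewrite !Plin !(cr (P _ y)) (cl y); lmod_signs K A.
move=> k l x y Dx Dy; rewrite /sw !(Phom _ _ _ Dx) !(Phom _ _ _ Dy) signzE oddzM.
have c0 z : c 0 z = 0 by apply: (linear_fun0 (cl z)).
have c0' z : c z 0 = 0 by apply: (linear_fun0 (cr z)).
by case: (oddz k); case: (oddz l) => /=;
  rewrite ?c0 ?c0' ?addr0 ?add0r ?subr0 ?expr1 ?expr0 ?scaleN1r ?scale1r.
Qed.

Variable c : A -> A -> A.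
Hypotheses (Bc : bilinear_op c)
  (degc : forall k l x y, D k x -> D l y -> D (k + l) (c x y))
  (prelie : forall k l m x y z, D k x -> D l y -> D m z ->
    c (c x y) z - c x (c y z) = (-1) ^ (l * m) *: (c (c x z) y - c x (c z y))).

(** The Jacobi identity expands into twelve products. The pre-Lie identity is used three times, with
    [x], [y] and [z] as the outer map; after these substitutions all terms cancel. *)
Lemma prelie_graded_lie (b : A -> A -> A) : bilinear_op b ->
  (forall k l x y, D k x -> D l y -> b x y = c x y - (-1) ^ (k * l) *: c y x) ->
  is_graded_lie D b.
Proof.
move=> Bb bE; have [cr cl] := Bc.
have degb k l x y : D k x -> D l y -> D (k + l) (b x y).
  move=> Dx Dy; rewrite (bE _ _ _ _ Dx Dy) [c x y - _]addrC -scaleNr.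
  by apply: (grading_linear_comb gradA); [rewrite addrC|]; apply: degc.
split=> // [k l x y Dx Dy|k l m x y z Dx Dy Dz].
  rewrite (bE _ _ _ _ Dx Dy) (bE _ _ _ _ Dy Dx) !signzE !oddzM.
  lmod_signs K A.
rewrite (bE _ _ _ _ Dx (degb _ _ _ _ Dy Dz)) (bE _ _ _ _ (degb _ _ _ _ Dx Dy) Dz).
rewrite (bE _ _ _ _ Dy (degb _ _ _ _ Dx Dz)).
rewrite (bE _ _ _ _ Dx Dy) (bE _ _ _ _ Dx Dz) (bE _ _ _ _ Dy Dz).
have cB u v w : c (u - v) w = c u w - c v w by apply: (linear_funB (cl w)).
have cB' u v w : c w (u - v) = c w u - c w v by apply: (linear_funB (cr w)).
have cZ a u w : c (a *: u) w = a *: c u w by apply: (linear_funZ (cl w)).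
have cZ' a u w : c w (a *: u) = a *: c w u by apply: (linear_funZ (cr w)).
rewrite !cB !cB' !cZ !cZ' !signzE !oddzM !oddzD.
have E u v w a : c (c u v) w - c u (c v w) = a *: (c (c u w) v - c u (c w v)) ->
    c (c u v) w = c u (c v w) + a *: (c (c u w) v - c u (c w v)).
  by move=> <-; rewrite addrC subrK.
rewrite (E _ _ _ _ (prelie Dx Dy Dz)) (E _ _ _ _ (prelie Dy Dx Dz)).
rewrite (E _ _ _ _ (prelie Dz Dx Dy)) !signzE !oddzM.
lmod_signs K A.
Qed.

End GradedBilinear.

Section Composition.
Variables (K : fieldType) (V : lmodType K) (D : int -> V -> Prop).
Hypothesis gradV : is_grading D.
Variable pi : bool -> V -> V.
Hypothesis piP : parity_proj D pi.
Local Notation homs := (stens D -> V).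
Implicit Types (F G : homs).

Definition letter_map F : seq (letter V) -> V := sep pi (eval_words F).

Lemma letter_map_ZD a F F' : letter_map (a *: F + F') = fun w => a *: letter_map F w + letter_map F' w.
Proof.
apply/funext => w; rewrite /letter_map -sep_ZD; congr sep.
by apply/funext => u; apply/funext => -[|v w'] //=; rewrite scaler0 addr0.
Qed.

Section Linear.
Variable F : homs.
Hypothesis lF : linear F.
Lemma letter_map_multilin : multilin (letter_map F). Proof. exact/(sep_multilin piP)/eval_words_biword. Qed.
Lemma letter_map_supersym : supersym (letter_map F). Proof. exact/(sep_supersym piP)/eval_words_biword. Qed.
Lemma letter_map_proj_inv : proj_inv pi (letter_map F). Proof. exact: (sep_proj_inv piP). Qed.
Lemma letter_map_colorless w : ~~ has (@color K V) w -> letter_map F w = 0.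
Proof. exact: sep_colorless. Qed.
End Linear.

Lemma letter_map_hom k F : hom_deg k F -> words_hom D k (letter_map F).
Proof. by move=> H; apply: (sep_hom gradV piP); apply: eval_words_deg. Qed.

(* Only the parity of [g] contributes, see [comp_parity]; this makes the product
   bilinear in maps that need not be homogeneous. *)
Definition comp_all (f g : seq (letter V) -> V) w := precomp false f g w + precomp true f g w.

Lemma comp_parity l (f g : seq (letter V) -> V) :
  multilin f -> proj_inv pi f -> multilin g -> proj_inv pi g -> words_hom D l g ->
  comp_all f g = precomp (oddz l) f g.
Proof.
move=> Mf Pf Mg Pg Hg; have := comp_wrong_parity gradV piP Mf Pf Mg Pg Hg.
rewrite /comp_all; case: (oddz l) => /= ->; apply/funext => w.
  by rewrite add0r.
by rewrite addr0.
Qed.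

Definition circ0 F G : homs := stens_ext (label_sum2 (comp_all (letter_map F) (letter_map G))).

Lemma circ0_linl a F F' G : circ0 (a *: F + F') G = a *: circ0 F G + circ0 F' G.
Proof.
apply/funext => t; rewrite /circ0 letter_map_ZD.
apply: etrans (stens_ext_ZD a (label_sum2 (comp_all (letter_map F) (letter_map G)))
  (label_sum2 (comp_all (letter_map F') (letter_map G))) t); congr (stens_ext _ _).
apply/funext => w; apply/funext => w'; rewrite -label_sum2_ZD; congr (label_sum2 _ _ _).
apply/funext => z; rewrite /comp_all !comp_ZDl; lmod_signs K V.
Qed.

Lemma circ0_linr a F G G' : linear F ->
  circ0 F (a *: G + G') = a *: circ0 F G + circ0 F G'.
Proof.
move=> lF; apply/funext => t; rewrite /circ0 letter_map_ZD.
apply: etrans (stens_ext_ZD a (label_sum2 (comp_all (letter_map F) (letter_map G)))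
  (label_sum2 (comp_all (letter_map F) (letter_map G'))) t); congr (stens_ext _ _).
apply/funext => w; apply/funext => w'; rewrite -label_sum2_ZD; congr (label_sum2 _ _ _).
apply/funext => z; rewrite /comp_all !comp_ZDr; try exact: letter_map_multilin.
lmod_signs K V.
Qed.

Lemma circ0_parity F G l : linear F -> hom_deg l G ->
  circ0 F G = stens_ext (label_sum2 (precomp (oddz l) (letter_map F) (letter_map G))).
Proof.
move=> lF HG; rewrite /circ0 (@comp_parity l) //;
  do ?[exact: letter_map_multilin | exact: letter_map_proj_inv | exact: letter_map_hom];
  by apply: letter_map_multilin; case: HG.
Qed.

Section CompInvariance.
Variables (b : bool) (F G : homs).
Hypotheses (lF : linear F) (lG : linear G).
Let phi := precomp b (letter_map F) (letter_map G).

Lemma comp_letter_map_multilin : multilin phi.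
Proof. by apply: comp_multilin; apply: letter_map_multilin. Qed.
Lemma comp_letter_map_supersym : supersym phi.
Proof. by apply: comp_supersym; do ?[exact: letter_map_multilin | exact: letter_map_supersym]. Qed.
Lemma comp_letter_map_proj_inv : proj_inv pi phi.
Proof. by apply: comp_proj_inv; apply: letter_map_proj_inv. Qed.
Lemma comp_letter_map_biword : biword D (label_sum2 phi).
Proof.
exact: (label_sum2_biword piP comp_letter_map_multilin comp_letter_map_proj_inv
  comp_letter_map_supersym).
Qed.
Lemma comp_letter_map_colorless w : ~~ has (@color K V) w -> phi w = 0.
Proof.
by apply: comp_colored; do ?[exact: letter_map_multilin | exact: letter_map_colorless].
Qed.

Lemma letter_map_stens_ext : letter_map (stens_ext (label_sum2 phi)) = phi.
Proof.
rewrite /letter_map -[RHS](sep_label_sum2 piP comp_letter_map_multilin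
  comp_letter_map_proj_inv comp_letter_map_supersym).
congr sep; apply/funext => w; apply/funext => -[|v w'].
  by rewrite label_sum2_nil //; apply: comp_letter_map_colorless.
exact: (stens_extE comp_letter_map_biword).
Qed.

End CompInvariance.

Lemma circ0_hom k l F G : hom_deg k F -> hom_deg l G -> hom_deg (k + l) (circ0 F G).
Proof.
move=> HF HG; have [[lF _] [lG _]] := (HF, HG).
rewrite (circ0_parity lF HG); apply: (stens_ext_deg gradV).
  exact: comp_letter_map_biword.
apply: (label_sum2_deg piP).
- exact: comp_letter_map_multilin.
- exact: comp_letter_map_proj_inv.
by apply: (comp_hom gradV); apply: letter_map_hom.
Qed.

Lemma letter_map_circ0 l F G : linear F -> hom_deg l G ->
  letter_map (circ0 F G) = precomp (oddz l) (letter_map F) (letter_map G).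
Proof.
by move=> lF HG; rewrite (circ0_parity lF HG) letter_map_stens_ext //; case: HG.
Qed.

Lemma circ0_prelie k l m F G H : hom_deg k F -> hom_deg l G -> hom_deg m H ->
  circ0 (circ0 F G) H - circ0 F (circ0 G H)
  = (-1) ^ (l * m) *: (circ0 (circ0 F H) G - circ0 F (circ0 H G)).
Proof.
move=> HF HG HH.
have [lF lG lH] : [/\ linear F, linear G & linear H] by split; case: HF HG HH => + _ [+ _] [+ _].
have [lFG _] := circ0_hom HF HG; have [lFH _] := circ0_hom HF HH.
rewrite (circ0_parity lFG HH) (letter_map_circ0 lF HG) (circ0_parity lF (circ0_hom HG HH)).
rewrite (letter_map_circ0 lG HH) (circ0_parity lFH HG) (letter_map_circ0 lF HH).
rewrite (circ0_parity lF (circ0_hom HH HG)) (letter_map_circ0 lH HG).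
have P := comp_prelie (oddz l) (oddz m) _ (letter_map_multilin lF) (letter_map_supersym lF)
  (letter_map_multilin lG) (letter_map_multilin lH).
pose Psi (phi : seq (letter V) -> V) : homs := stens_ext (label_sum2 phi).
have L : linear Psi.
  move=> a phi psi; apply/funext => t.
  apply: etrans (stens_ext_ZD a (label_sum2 phi) (label_sum2 psi) t); congr (stens_ext _ _).
  by apply/funext => w; apply/funext => w'; rewrite -label_sum2_ZD.
rewrite -!/(Psi _) -!(linear_funB L) -(linear_funZ L); congr Psi.
apply/funext => w; rewrite signzE oddzM !oddzD [oddz l && _]andbC [oddz l (+) _]addbC.
exact: P.
Qed.

Lemma hom_span_linear F : lspan (fun f => exists k, hom_deg k f) F -> linear F.
Proof.
elim=> [|a G H [k [lG _]] _ lH] b x y; first by rewrite scaler0 addr0.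
have E z : (a *: G + H) z = a *: G z + H z by [].
by rewrite !E lG lH !scalerDr !scalerA [a * b]mulrC addrACA.
Qed.

Lemma gHom_linear (f : gHom D) : linear (val f).
Proof. by apply: hom_span_linear; case: f => f /= /asboolP. Qed.

Lemma circ0_span F G : lspan (fun f => exists k, hom_deg k f) F ->
  lspan (fun f => exists k, hom_deg k f) G -> lspan (fun f => exists k, hom_deg k f) (circ0 F G).
Proof.
move=> HF HG; have lF := hom_span_linear HF.
have lin0 (E : homs -> homs) : (forall a x y, E (a *: x + y) = a *: E x + E y) -> E 0 = 0.
  exact: linear_fun0.
elim: HF => [|a F1 F2 [k HF1] HF2 IH].
  by rewrite (lin0 (circ0^~ G)) => [|a x y]; [exact: lspan0|exact: circ0_linl].
rewrite circ0_linl; apply: lspanD IH; apply: lspanZ.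
have lF1 : linear F1 by case: HF1.
elim: HG => [|b G1 G2 [l HG1] HG2 IH].
  by rewrite (lin0 (circ0 F1)) => [|c x y]; [exact: lspan0|exact: circ0_linr].
rewrite circ0_linr //; apply: lspanD IH; apply: lspanZ.
by apply: sub_lspan; exists (k + l); apply: circ0_hom.
Qed.

Lemma circ_subproof (f g : gHom D) :
  circ0 (val f) (val g) \in spanp (fun f : homs => exists k, hom_deg k f).
Proof.
apply/asboolP; apply: circ0_span.
  by case: f => f /= /asboolP.
by case: g => g /= /asboolP.
Qed.

Definition circ (f g : gHom D) : gHom D := Spanned (circ_subproof f g).

Lemma val_circ f g : val (circ f g) = circ0 (val f) (val g). Proof. by []. Qed.

Lemma circ_bilinear : bilinear_op circ.
Proof.
split=> [f a g h|g a f h]; apply: val_inj.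
  rewrite gHom_val_linear !val_circ gHom_val_linear; apply: circ0_linr; exact: gHom_linear.
by rewrite gHom_val_linear !val_circ gHom_val_linear; apply: circ0_linl.
Qed.

Lemma circ_deg k l f g : gHom_deg k f -> gHom_deg l g -> gHom_deg (k + l) (circ f g).
Proof. exact: circ0_hom. Qed.

Lemma circ_prelie k l m (f g h : gHom D) :
  gHom_deg k f -> gHom_deg l g -> gHom_deg m h ->
  circ (circ f g) h - circ f (circ g h)
  = (-1) ^ (l * m) *: (circ (circ f h) g - circ f (circ h g)).
Proof.
move=> Hf Hg Hh; apply: val_inj.
have L := @gHom_val_linear _ _ D.
rewrite (linear_funZ L) !(linear_funB L); exact: (circ0_prelie Hf Hg Hh).
Qed.

End Composition.

(** * The shuffle formula for the product *)

Section ShuffleFormula.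
Variables (K : fieldType) (V : lmodType K) (D : int -> V -> Prop).
Hypothesis gradV : is_grading D.
Variable pi : bool -> V -> V.
Hypothesis piP : parity_proj D pi.

Section Letters.
Variables (T : Type) (x : T -> V) (d : T -> int).
Hypothesis Dx : forall t, D (d t) (x t).
Let L c (t : T) := lab c (oddz (d t)) (x t).

Lemma label_sum_map c (phi : seq (letter V) -> V) w : multilin phi -> proj_inv pi phi ->
  label_sum c phi (map x w) = phi (map (L c) w).
Proof.
elim: w phi => //= t w IH phi M P.
rewrite -[LHS]/(label_sum c phi (x t :: map x w)) (label_sum_hom_cons piP _ _ M P (Dx t)) IH //.
  exact: multilin_cons.
exact: proj_inv_cons.
Qed.

Lemma letters_deg_map c w : letters_deg D (\sum_(t <- w) d t) (map (L c) w).
Proof.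
elim: w => [|t w IH] /=; first by rewrite big_nil; apply: letters_deg0.
by rewrite big_cons; apply: letters_degS.
Qed.

Lemma oddz_sum w : oddz (\sum_(t <- w) d t) = tpar (fun t => oddz (d t)) w.
Proof. by elim: w => [|t w IH]; rewrite ?big_nil // big_cons oddzD IH. Qed.

Lemma pi_homog i v : D i v -> pi (oddz i) v = v.
Proof. by case: piP => _ _ _ H Dv; rewrite (H _ _ _ Dv) eqxx. Qed.

Lemma L_sorted c w : all (fun z : letter V =>
  (if c then color z else ~~ color z) && (pi (par z) z.2.2 == z.2.2)) (map (L c) w).
Proof.
by elim: w => //= t w ->; rewrite andbT; case: c; rewrite /= !parE (pi_homog (Dx t)) eqxx.
Qed.

Lemma L_vec c w : [seq z.2.2 | z <- map (L c) w] = map x w.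
Proof. by rewrite -map_comp. Qed.

End Letters.

Lemma take_enum n k : take k (enum 'I_n) = [seq i : 'I_n <- enum 'I_n | (i < k)%N].
Proof.
apply: (inj_map val_inj); rewrite map_take val_enum_ord.
rewrite (_ : map val _ = [seq i <- iota 0 n | (i < k)%N]); last first.
  by rewrite -val_enum_ord filter_map.
have [kn|nk] := leqP k n; last first.
  rewrite take_oversize ?size_iota 1?ltnW //; apply/esym/all_filterP/allP => i.
  by rewrite mem_iota => /andP[_ i_n]; apply: leq_trans i_n (ltnW nk).
rewrite -[in LHS](subnKC kn) iotaD take_size_cat ?size_iota //.
rewrite -[in RHS](subnKC kn) iotaD filter_cat.
rewrite (all_filterP _) => [|]; last by apply/allP => i; rewrite mem_iota.
rewrite (_ : [seq _ <- iota _ (n - k) | _] = [::]) ?cats0 //.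
rewrite -(filter_pred0 (iota (0 + k) (n - k))).
by apply: eq_in_filter => i; rewrite mem_iota add0n => /andP[ki _]; rewrite ltnNge ki.
Qed.

Lemma ev_eval_words (f : gHom D) w w' : w' != [::] -> ev f w w' = eval_words (val f) w w'.
Proof. by case: w'. Qed.

Variables (k l : int) (f g : gHom D).
Hypotheses (Hf : gHom_deg k f) (Hg : gHom_deg l g).
Variables (n m : nat) (x : 'I_n -> V) (dx : 'I_n -> int) (y : 'I_m -> V) (dy : 'I_m -> int).
Hypotheses (m_gt0 : (0 < m)%N) (Dx : forall i, D (dx i) (x i))
  (Dy : forall j, D (dy j) (y j)).

Let tf := letter_map pi (val f).
Let tg := letter_map pi (val g).
Let lf : linear (val f) := proj1 Hf.
Let lg : linear (val g) := proj1 Hg.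
Let px i := oddz (dx i).
Let py j := oddz (dy j).
Let X c i := lab c (px i) (x i).
Let Y j := lab true (py j) (y j).

Lemma letter_map_sorted_words (F : stens D -> V) a b :
  letter_map pi F (map (X false) a ++ map (X true) b) = eval_words F (map x a) (map x b).
Proof.
rewrite /letter_map sep_sorted ?L_vec //; first exact: (L_sorted Dx false).
exact: (L_sorted Dx true).
Qed.

Lemma letter_map_sorted_words2 (F : stens D -> V) a b :
  letter_map pi F (map (X false) a ++ map Y b) = eval_words F (map x a) (map y b).
Proof.
rewrite /letter_map sep_sorted ?L_vec //; first exact: (L_sorted Dx false).
exact: (L_sorted Dy true).
Qed.

(** The label that the insertion gives to the value of [g] is its true parity, so the projection in
    [letter_map] leaves that value unchanged. *)
Lemma tg_hom1 a b : exists2 i,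
  D i (eval_words (val g) (map x a) (map x b)) & oddz i = oddz l (+) tpar px a (+) tpar px b.
Proof.
exists (\sum_(t <- a) dx t + \sum_(t <- b) dx t + l).
  rewrite -letter_map_sorted_words; apply: (letter_map_hom gradV piP Hg).
  by apply: letters_deg_cat; apply: letters_deg_map.
by rewrite !oddzD !oddz_sum addbC addbA.
Qed.

Lemma tg_hom2 a b : exists2 i,
  D i (eval_words (val g) (map x a) (map y b)) & oddz i = oddz l (+) tpar px a (+) tpar py b.
Proof.
exists (\sum_(t <- a) dx t + \sum_(t <- b) dy t + l).
  rewrite -letter_map_sorted_words2; apply: (letter_map_hom gradV piP Hg).
  by apply: letters_deg_cat; apply: letters_deg_map.
by rewrite !oddzD !oddz_sum addbC addbA.
Qed.

Lemma tf_term1 a b c :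
  tf (lab false (oddz l (+) tpar px a (+) tpar px b) (tg (map (X false) a ++ map (X true) b))
        :: map (X false) c ++ map Y (enum 'I_m))
  = eval_words (val f) (eval_words (val g) (map x a) (map x b) :: map x c) (word y).
Proof.
rewrite /tf /tg letter_map_sorted_words; have [i Di <-] := tg_hom1 a b.
rewrite -cat_cons /letter_map sep_sorted /= ?L_vec //.
  by rewrite !parE (pi_homog Di) eqxx; apply: (L_sorted Dx false).
exact: (L_sorted Dy true).
Qed.

Lemma tf_term2 a b c e :
  tf (map (X false) a ++ lab true (oddz l (+) tpar px b (+) tpar py c)
        (tg (map (X false) b ++ map Y c)) :: map Y e)
  = eval_words (val f) (map x a) (eval_words (val g) (map x b) (map y c) :: map y e).
Proof.
rewrite /tf /tg letter_map_sorted_words2; have [i Di <-] := tg_hom2 b c.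
rewrite /letter_map sep_sorted /= ?L_vec //; first exact: (L_sorted Dx false).
by rewrite !parE (pi_homog Di) eqxx; apply: (L_sorted Dy true).
Qed.

Lemma eval_words_linear0l (F : stens D -> V) w w' : linear F -> eval_words F (0 :: w) w' = 0.
Proof.
move=> lF; have [M _ _ _] := eval_words_biword lF.
by have := M w' [::] (-1) 0 0 w; rewrite scaler0 addr0 scaleN1r addNr.
Qed.

Lemma eval_words_linear0r (F : stens D -> V) w w' : linear F -> eval_words F w (0 :: w') = 0.
Proof.
move=> lF; have [_ _ M _] := eval_words_biword lF.
by have := M w [::] (-1) 0 0 w'; rewrite scaler0 addr0 scaleN1r addNr.
Qed.

Let y_nil : word y != [::].
Proof. by rewrite -size_eq0 size_map size_enum_ord -lt0n. Qed.

Lemma word_comp (U : Type) r (u : 'I_r -> U) (s : 'S_r) :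
  [seq (u \o s) i | i <- enum 'I_r] = map u (map s (enum 'I_r)).
Proof. by elim: (enum _) => //= i w ->. Qed.

Lemma size_word_perm (U : Type) r (u : 'I_r -> U) (s : 'S_r) :
  size (map u (map s (enum 'I_r))) = r.
Proof. by rewrite 2!size_map size_enum_ord. Qed.

Lemma inner_sum :
  split3 px (fun a b c =>
      eval_words (val f) (eval_words (val g) (map x a) (map x b) :: map x c) (word y))
    (enum 'I_n)
  = \sum_(0 <= p < n) \sum_(1 <= q < n.+1 | (p + q <= n)%N)
    \sum_(s : 'S_n | shuffle [:: p; q; n - p - q]%N s)
     (let w := word (x \o s) in
      koszul K dx s *:
      ev f (ev g (take p w) (take q (drop p w)) :: drop (p + q)%N w) (word y)).
Proof.
rewrite split3_shuffles.
pose G q r := \sum_(s : 'S_n | shuffle [:: q; r; n - q - r]%N s)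
  (let w := map s (enum 'I_n) in
   koszul K dx s *: eval_words (val f) (eval_words (val g) (map x (take q w))
     (map x (take r (drop q w))) :: map x (drop (q + r) w)) (word y)).
(* With an empty second block [g] is evaluated on an empty second word, and a zero letter is
   inserted into [f]. *)
have G0 q : G q 0 = 0.
  by apply: big1 => s _; rewrite /= take0 /= eval_words_linear0l // scaler0.
have E q : \sum_(0 <= r < n.+1 | (q + r <= n)%N) G q r
  = \sum_(1 <= r < n.+1 | (q + r <= n)%N)
    \sum_(s : 'S_n | shuffle [:: q; r; n - q - r]%N s)
     (let w := word (x \o s) in
      koszul K dx s *:
      ev f (ev g (take q w) (take r (drop q w)) :: drop (q + r)%N w) (word y)).
  rewrite big_ltn_cond // G0 add0r if_same /G.
  rewrite big_nat_cond [RHS]big_nat_cond.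
  apply: eq_bigr => r /andP[/andP[r_gt0 _] qr]; apply: eq_bigr => s _.
  rewrite /= /word word_comp !map_take !map_drop.
  rewrite [ev g _ _]ev_eval_words ?[ev f _ _]ev_eval_words //.
  rewrite -size_eq0 size_take size_drop size_word_perm.
  have qr' : (r <= n - q)%N by rewrite leq_subRL // (leq_trans _ qr) ?leq_addr.
  by case: ifP; rewrite -lt0n // => _; apply: leq_trans qr'.
rewrite -/(G _ _); under eq_bigr do rewrite E.
(* A first block of length n leaves no room for a nonempty second block, so the last index drops
   out. *)
rewrite big_nat_recr //= [X in _ + X]big_nat_cond [X in _ + X]big1 ?addr0 // => r.
by case/andP=> /andP[r_gt0 _]; rewrite -{2}[n]addn0 leq_add2l leqNgt r_gt0.
Qed.

Lemma outer_sum :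
  split2 px (fun a b => split2 py (fun c e =>
      (-1) ^+ (oddz l && tpar px a) *:
      eval_words (val f) (map x a) (eval_words (val g) (map x b) (map y c) :: map y e)) (enum 'I_m))
    (enum 'I_n)
  = \sum_(0 <= p < n.+1) \sum_(s : 'S_n | shuffle [:: n - p; p]%N s)
    \sum_(1 <= q < m.+1) \sum_(t : 'S_m | shuffle [:: q; m - q]%N t)
     (let w := word (x \o s) in
      let w' := word (y \o t) in
      (koszul K dx s * koszul K dy t
       * (-1) ^ (l * (\sum_(i < n | (i < n - p)%N) dx (s i)))) *:
      ev f (take (n - p)%N w)
           (ev g (drop (n - p)%N w) (take q w') :: drop q w')).
Proof.
rewrite split2_shuffles_rev; apply: eq_bigr => p _; apply: eq_bigr => s _.
cbv zeta; rewrite split2_shuffles big_ltn //.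
(* The term q = 0, in which [g] receives no letter of [y] and hence has value 0. *)
set F0 := (X in _ *: (X + _)).
have -> : F0 = 0.
  apply: big1 => t _; cbv zeta.
  by rewrite take0 -[eval_words (val g) _ _]/(0 : V) eval_words_linear0r // !scaler0.
rewrite add0r.
rewrite scaler_sumr big_nat_cond [RHS]big_nat_cond.
apply: eq_bigr => q /andP[/andP[q_gt0 qm] _].
rewrite scaler_sumr; apply: eq_bigr => t _.
rewrite /= /word !word_comp !map_take !map_drop !scalerA.
rewrite [ev g _ _]ev_eval_words ?[ev f _ _]ev_eval_words //; last first.
  rewrite -size_eq0 size_take size_word_perm.
  by case: ifP; rewrite -lt0n // => _; apply: leq_trans m_gt0.
congr (_ * _ *: _); rewrite signzE oddzM; congr (_ ^+ (_ && _)).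
rewrite -oddz_sum -map_take take_enum big_map big_filter big_enum_cond.
by congr oddz.
Qed.

Lemma circ_formula : ev (circ gradV piP f g) (word x) (word y) = circ_rhs l f g x dx y dy.
Proof.
rewrite /ev val_circ (circ0_parity gradV piP lf Hg) stens_extE //; last exact: comp_letter_map_biword.
have M := comp_letter_map_multilin piP (oddz l) lf lg.
have P := comp_letter_map_proj_inv piP (oddz l) (val f) (val g).
rewrite /label_sum2 /word (label_sum_map Dx);
  [|exact: multilin_label_sum_cat|exact: proj_inv_label_sum_cat].
rewrite (label_sum_map Dy); [|exact: multilin_cat|exact: proj_inv_cat].
rewrite /precomp /coder_act /= /circ_rhs; congr (_ + _).
- rewrite ins_recolor_split3;
    do ?[exact: letter_map_multilin | exact: letter_map_supersym
        | by rewrite all_map; apply/allP].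
  rewrite -inner_sum; congr split3.
  apply/funext => a; apply/funext => b; apply/funext => c; exact: tf_term1.
rewrite ins_split2; do ?[exact: letter_map_multilin | exact: letter_map_supersym].
rewrite -outer_sum; congr split2; apply/funext => a; apply/funext => b.
congr split2; apply/funext => c; apply/funext => e.
by congr (_ *: _); apply: tf_term2.
Qed.

End ShuffleFormula.

(** * Uniqueness *)

Section Uniqueness.
Variables (K : fieldType) (V : lmodType K) (D : int -> V -> Prop).
Hypothesis gradV : is_grading D.

Lemma word_deg_word d w : word_deg D d w ->
  exists (x : 'I_(size w) -> V) (dx : 'I_(size w) -> int),
    (forall i, D (dx i) (x i)) /\ word x = w.
Proof.
move=> Dw; have Dnth i : (i < size w)%N -> exists j, D j (nth 0 w i).
  elim: Dw i => // j e v u Dv _ IH [|i] /=; first by exists j.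
  exact: IH.
have /choice[dx Ddx] (i : 'I_(size w)) : exists j, D j (nth 0 w i) by apply: Dnth.
exists (fun i => nth 0 w i), dx; split=> //.
by rewrite /word (map_comp (nth 0 w) val) val_enum_ord map_nth_iota0 // take_size.
Qed.

Lemma gHom_ext k l (f g : gHom D) : gHom_deg k f -> gHom_deg l g ->
  (forall n m (x : 'I_n -> V) dx (y : 'I_m -> V) dy, (0 < m)%N ->
    (forall i, D (dx i) (x i)) -> (forall j, D (dy j) (y j)) ->
    ev f (word x) (word y) = ev g (word x) (word y)) -> f = g.
Proof.
move=> [lf _] [lg _] H; apply: val_inj.
apply: (linear_stens_ext gradV lf lg) => _ [d [e [w [w' [Dw Dw' w'0 ->]]]]].
have [x [dx [Dx xE]]] := word_deg_word Dw.
have [y [dy [Dy yE]]] := word_deg_word Dw'.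
have m0 : (0 < size w')%N by rewrite lt0n size_eq0.
by have := H _ _ x dx y dy m0 Dx Dy; rewrite /ev xE yE.
Qed.

(** The formula fixes the product of two homogeneous maps on homogeneous words, which span the
    tensors; bilinearity extends this to sums of maps of different degrees. *)
Lemma is_circ_unique (c c' : gHom D -> gHom D -> gHom D) :
  is_circ c -> is_circ c' -> c = c'.
Proof.
move=> [Bc Hc] [Bc' Hc']; apply: (bilinear_ext (gHom_grading gradV) Bc Bc').
move=> k l f g Hf Hg; have [Hk E] := Hc _ _ _ _ Hf Hg; have [Hk' E'] := Hc' _ _ _ _ Hf Hg.
apply: (gHom_ext Hk Hk') => n m x dx y dy m0 Dx Dy.
by rewrite (E _ _ _ dx _ dy) // (E' _ _ _ dx _ dy).
Qed.

End Uniqueness.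

Theorem theorem2p15 (K : fieldType) (charK : [pchar K] =i pred0)
    (V : lmodType K) (Vdeg : int -> V -> Prop) (gradV : is_grading Vdeg) :
  exists circ : gHom Vdeg -> gHom Vdeg -> gHom Vdeg,
    unique (@is_circ K V Vdeg) circ /\
    exists br : gHom Vdeg -> gHom Vdeg -> gHom Vdeg,
      unique (is_PL_bracket circ) br /\
      is_graded_lie (@gHom_deg K V Vdeg) br.
Proof.
have [pi piP] := parity_proj_exists gradV.
have gradH := gHom_grading gradV.
pose c := circ gradV piP.
have Bc : bilinear_op c by apply: circ_bilinear.
have Hc : is_circ c.
  split=> // k l f g Hf Hg; split; first exact: circ_deg.
  by move=> n m x dx y dy m0 Dx Dy; exact: (circ_formula gradV piP Hf Hg m0 Dx Dy).
exists c; split; first by split=> // c' Hc'; apply: is_circ_unique Hc Hc'.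
have [b [Bb bE]] := supercommutator_exists gradH Bc.
exists b; split.
  split=> // b' [Bb' b'E]; apply: (bilinear_ext gradH Bb Bb') => k l f g Hf Hg.
  by rewrite (bE _ _ _ _ Hf Hg) (b'E _ _ _ _ Hf Hg).
apply: (prelie_graded_lie gradH Bc) Bb bE => [k l f g|k l m f g h].
  exact: circ_deg.
exact: circ_prelie.
Qed.
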